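(* Let $(O_n)_{n\ge1}$ be either the sequence of origamis built from $L(2,3)$ or the sequence of origamis built from $D$ (both defined in the context). Then the following hold. \begin{itemize} \item For all $n\ge1$, $\Gamma(O_n)\subseteq\Gamma(O_1)$, and $\Gamma(O_1)$ is (for both sequences) a non congruence group. \item More generally, for all $n,m\ge1$: if $n$ divides $m$, then $\Gamma(O_m)\subseteq\Gamma(O_n)$. \item Different origamis in one sequence have different Veech groups, i.e. $\Gamma(O_n)\neq\Gamma(O_m)$ for $n\neq m$. \end{itemize}
   Context: Fix the torus $E=\mathbb{C}/(\mathbb{Z}\oplus\mathbb{Z}i)$ (the unit square with opposite edges glued), and let $\infty\in E$ be the image of the vertices of the square. An origami of degree $d$ is a covering $p:X\to E$ of degree $d$ from a closed, oriented, connected surface $X$, ramified over at most $\infty$. Equivalently, it is given by a pair of permutations $(\sigma_a,\sigma_b)$ in $S_d$ generating a transitive group (up to simultaneous conjugation): take $d$ copies of the Euclidean unit square numbered $1,\dots,d$, and glue by translations the right edge of square $i$ to the left edge of square $\sigma_a(i)$ and the upper edge of square $i$ to the lower edge of square $\sigma_b(i)$. Sequence built from $L(2,3)$: $O_n$ is the origami of degree $4n$ given by $$\sigma_a=(1\ 3\ 4\ \ 5\ 7\ 8\ \ 9\ 11\ 12\ \ldots\ 4n-3\ \ 4n-1\ \ 4n)\ \text{(one cycle of length } 3n),$$ $$\sigma_b=(1\ 2)(5\ 6)\cdots(4n-3\ \ 4n-2).$$ Here $O_1=L(2,3)$. Sequence built from $D$: $O_n$ (also written $D_n$) is the origami of degree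 $5n$ given by $$\sigma_a=(1\ 2\ 3\ \ 6\ 7\ 8\ \ldots\ 5n-4\ \ 5n-3\ \ 5n-2)\ \text{(one cycle of length } 3n),$$ $$\sigma_b=(1\ 4\ 5)(6\ 9\ 10)\cdots(5n-4\ \ 5n-1\ \ 5n)\,(2\ 3)(7\ 8)\cdots(5n-3\ \ 5n-2).$$ Here $O_1=D$. Veech group: for an origami $O=(p:X\to E)$ put $X^*=X-p^{-1}(\infty)$, with the translation structure $\mu_I$ obtained by lifting via $p$ the natural one of $\mathbb{C}/(\mathbb{Z}\oplus\mathbb{Z}i)$. The Veech group $\Gamma(O)$ is the group of all matrices $A$ such that there is an orientation preserving diffeomorphism of $X^*$ which in local charts of $\mu_I$ has the form $z\mapsto Az+z_0$ ($A\in\mathrm{GL}_2(\mathbb{R})$ is independent of the charts). It is a finite index subgroup of $\mathrm{SL}_2(\mathbb{Z})$. A congruence group is a subgroup of $\mathrm{SL}_2(\mathbb{Z})$ that contains $\Gamma(n)=\ker(\mathrm{SL}_2(\mathbb{Z})\to\mathrm{SL}_2(\mathbb{Z}/n\mathbb{Z}))$ for some $n\ge1$. A non congruence group is a subgroup of $\mathrm{SL}_2(\mathbb{Z})$ that is not a congruence group. *)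

(* Defs.v *)
From HB Require Import structures.
From mathcomp Require Import all_boot all_order all_algebra all_fingroup.
From mathcomp Require Import all_classical all_reals all_analysis.
From mathcomp Require Import zify.

Set Implicit Arguments.
Unset Strict Implicit.
Unset Printing Implicit Defensive.

Import Order.TTheory GRing.Theory Num.Theory.
Import numFieldNormedType.Exports.

(* [undup] only serves to make this total: all cycles used below are
   duplicate-free. *)
Definition cycle_perm (T : finType) (c : seq T) : {perm T} :=
  perm (can_inj (prev_next (undup_uniq c))).

(* The cycle (k_1 k_2 ... k_l) in 'S_d, written with labels 1, ..., d: the label
   k stands for the ordinal k.-1 of 'I_d. *)
Definition cyc (d : nat) (c : seq nat) : 'S_d :=
  cycle_perm (pmap (insub : nat -> option 'I_d) [seq k.-1 | k <- c]).

(* The right edge of square i is glued to the left edge of square [glue_right i],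
   and the upper edge of square i to the lower edge of square [glue_up i]. *)
Record origami := Origami {
  degree : nat;
  glue_right : 'S_degree;
  glue_up : 'S_degree;
  origami_transitive :
    [transitive <<[set glue_right; glue_up]>>%g, on [set: 'I_degree] | 'P]
}.

Definition L23_right (n : nat) : 'S_(4 * n) :=
  cyc (4 * n) (flatten [seq [:: 4 * k - 3; 4 * k - 1; 4 * k] | k <- iota 1 n]).

Definition L23_up (n : nat) : 'S_(4 * n) :=
  (\prod_(1 <= k < n.+1) cyc (4 * n) [:: 4 * k - 3; 4 * k - 2]%N)%g.

Definition D_right (n : nat) : 'S_(5 * n) :=
  cyc (5 * n)
    (flatten [seq [:: 5 * k - 4; 5 * k - 3; 5 * k - 2] | k <- iota 1 n]).

Definition D_up (n : nat) : 'S_(5 * n) :=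
  ((\prod_(1 <= k < n.+1) cyc (5 * n) [:: 5 * k - 4; 5 * k - 1; 5 * k]%N) *
   (\prod_(1 <= k < n.+1) cyc (5 * n) [:: 5 * k - 3; 5 * k - 2]%N))%g.

Lemma cyc_val (d : nat) (c : seq nat) (x : 'I_d) :
    uniq c -> all (fun k => 0 < k <= d)%N c ->
  (cyc d c x).+1 = next c x.+1.
Proof.
move=> Uc rc; rewrite /cyc /cycle_perm permE.
set p := pmap _ _; have hI : injective (fun i : 'I_d => i.+1).
  by move=> i j [] /val_inj.
have pE : map (fun i : 'I_d => i.+1) p = c.
  rewrite /p; elim: c rc {Uc p} => [|k c IHc] //= /andP[/andP[k0 kd] /IHc rc].
  by rewrite insubT ?prednK //= => kd'; rewrite rc prednK.
have Up : uniq p by rewrite -(map_inj_uniq hI) pE.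
by rewrite undup_id // -[in RHS]pE (next_map hI).
Qed.

Lemma prod_cyc_id (d : nat) (r : seq nat) (F : nat -> seq nat) (x : 'I_d) :
    {in r, forall k, uniq (F k) && all (fun k => 0 < k <= d)%N (F k)} ->
    {in r, forall k, x.+1 \notin F k} ->
  (\prod_(k <- r) cyc d (F k))%g x = x.
Proof.
elim: r => [|k r IHr] rF xF; first by rewrite big_nil perm1.
have /andP[Uk rk] := rF k (mem_head _ _).
rewrite big_cons permM (_ : cyc d (F k) x = x).
  by apply: IHr => i ir; [apply: rF | apply: xF]; rewrite inE ir orbT.
apply/val_inj/succn_inj; rewrite cyc_val //.
by rewrite next_nth (negPf (xF k (mem_head _ _))).
Qed.

Lemma prod_cyc_val (d : nat) (r : seq nat) (F : nat -> seq nat) (j : nat)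
    (x : 'I_d) :
    uniq r ->
    {in r, forall k, uniq (F k) && all (fun k => 0 < k <= d)%N (F k)} ->
    {in r &, forall k l y, y \in F k -> y \in F l -> k = l} ->
    j \in r -> x.+1 \in F j ->
  ((\prod_(k <- r) cyc d (F k))%g x).+1 = next (F j) x.+1.
Proof.
elim: r x => [|k r IHr] x //= /andP[kr Ur] rF dF jr xj.
have /andP[Uk rk] := rF k (mem_head _ _).
have sr i : i \in r -> i \in k :: r by rewrite inE orbC => ->.
rewrite big_cons permM; have [jk | njk] := eqVneq j k.
  rewrite jk in xj *; rewrite prod_cyc_id ?cyc_val //.
    by move=> i /sr; apply: rF.
  move=> i ir; apply/negP => xi; move/negP: kr; apply.
  rewrite (dF k i (mem_head _ _) (sr _ ir) (next (F k) x.+1)) ?mem_next //.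
have jr' : j \in r by move: jr; rewrite inE (negPf njk).
have -> : cyc d (F k) x = x.
  apply/val_inj/succn_inj; rewrite cyc_val // next_nth ifN //.
  apply/negP => xk; case/eqP: njk.
  exact: dF (sr _ jr') (mem_head _ _) _ xj xk.
apply: IHr => //; first by move=> i /sr; apply: rF.
by move=> i l /sr ir /sr lr; apply: dF.
Qed.

(* The group generated by a and b acts transitively if the squares of one cycle
   of a, together with their images under b and b^2, exhaust all squares. *)
Lemma transitive_cyc (d : nat) (c : seq nat) (b : 'S_d) :
    uniq c -> c != [::] -> all (fun k => 0 < k <= d)%N c ->
    (forall x : 'I_d, exists2 y : 'I_d, y.+1 \in c &
       [\/ x = y, x = b y | x = b (b y)]) ->
  [transitive <<[set cyc d c; b]>>%g, on [set: 'I_d] | 'P].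
Proof.
move=> Uc c0 rc Hb; set G := <<_>>%g.
have aG : cyc d c \in G by apply: mem_gen; rewrite !inE eqxx.
have bG : b \in G by apply: mem_gen; rewrite !inE eqxx orbT.
case: c c0 Uc rc Hb @G aG bG => [//|k c] _ Uc rc Hb G aG bG.
have /andP[/andP[k0 kd] _] := rc.
have kd' : (k.-1 < d)%N by rewrite prednK.
pose x0 : 'I_d := Ordinal kd'.
have x0E : x0.+1 = k by rewrite /= prednK.
have orb y g : g \in G -> y \in orbit 'P G x0 -> g y \in orbit 'P G x0.
  by move=> gG /orbitP[h hG <-]; apply/orbitP; exists (h * g)%g;
    rewrite ?groupM //= /aperm permM.
have orbc (y : 'I_d) : y.+1 \in k :: c -> y \in orbit 'P G x0.
  have := cycle_next Uc; set f := next _ => cf yc.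
  have [m mE] : exists m, y.+1 = iter m f x0.+1.
    have /fpathP[l lE] : fpath f k (rcons c k) by [].
    have /trajectP[m _ mE] : y.+1 \in traject f k l.+1.
      by rewrite trajectS -lE inE mem_rcons inE orbA orbb -in_cons.
    by exists m; rewrite x0E.
  move: m y mE {yc}.
  elim=> [|m IHm] y /=.
    by move=> [] /= yE; rewrite (_ : y = x0) ?orbit_refl //; apply/val_inj.
  move=> yE.
  have mx : exists z : 'I_d, z.+1 = iter m f x0.+1.
    have : iter m f x0.+1 \in k :: c.
      by elim: (m) => [|i]; [rewrite x0E mem_head | rewrite /= mem_next].
    move/(allP rc); move: (iter m f _) => [|z] //= zd.
    by exists (Ordinal zd).
  have [z zE] := mx.
  rewrite (_ : y = cyc d (k :: c) z); first by apply: orb => //; apply: IHm.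
  by apply/val_inj/succn_inj; rewrite cyc_val // zE.
apply/imsetP; exists x0 => //; apply/setP => x; rewrite inE; apply/esym.
have [y /orbc yo] := Hb x.
by case=> ->; [| apply: (orb _ b) | apply: (orb _ b) => //; apply: (orb _ b)].
Qed.

Lemma L23_transitive (n : nat) : (0 < n)%N ->
  [transitive <<[set L23_right n; L23_up n]>>%g, on [set: 'I_(4 * n)] | 'P].
Proof.
rewrite /L23_right => n0; set c := flatten _.
have mc y : reflect (exists2 k, (0 < k <= n)%N &
    y \in [:: 4 * k - 3; 4 * k - 1; 4 * k]%N) (y \in c).
  apply: (iffP flatten_mapP) => [[k]|[k kn yk]]; last first.
    by exists k => //; rewrite mem_iota; lia.
  by rewrite mem_iota => kn yk; exists k => //; lia.
apply: transitive_cyc => //.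
- have pw m : forall i, (0 < i)%N -> pairwise ltn
      (flatten [seq [:: 4 * k - 3; 4 * k - 1; 4 * k]%N | k <- iota i m]).
    elim: m => [|m IHm] i i0 //.
    have H y : (y <= 4 * i)%N -> all (ltn y) (flatten
        [seq [:: 4 * k - 3; 4 * k - 1; 4 * k]%N | k <- iota i.+1 m]).
      move=> yi; apply/allP => z /flatten_mapP[k]; rewrite mem_iota !inE.
      by move=> ki /or3P[] /eqP ->; lia.
    by rewrite /= !H ?IHm ?andbT //; lia.
  by apply: (pairwise_uniq ltnn); apply: pw.
- apply/negP => /eqP c0; have : 1%N \in c; last by rewrite c0.
  by apply/mc; exists 1%N.
- by apply/allP => y /mc[k kn]; rewrite !inE => /or3P[] /eqP ->; lia.
move=> x; have xn := ltn_ord x.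
have [/mc xc|xc] := boolP (x.+1 \in c).
  by exists x; [apply/mc | apply: Or31].
pose k := (x %/ 4).+1.
have xk : x.+1 = (4 * k - 2)%N.
  have: ~~ (x.+1 \in [:: 4 * k - 3; 4 * k - 1; 4 * k]%N).
    by apply: contra xc => xk; apply/mc; exists k => //; lia.
  by rewrite !inE /k; lia.
have yd : (4 * k - 4 < 4 * n)%N by lia.
exists (Ordinal yd); first by apply/mc; exists k; rewrite ?inE /=; lia.
apply: Or32; apply/val_inj/succn_inj; rewrite /L23_up.
rewrite (@prod_cyc_val _ _ _ k) ?iota_uniq //=.
- by rewrite (_ : (4 * k - 4).+1 = 4 * k - 3)%N ?eqxx //; lia.
- by move=> i; rewrite mem_index_iota /= inE; lia.
- move=> i j; rewrite !mem_index_iota => ? ? y; rewrite !inE.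
  by lia.
- by rewrite mem_index_iota; lia.
- by rewrite !inE; lia.
Qed.

Lemma D_transitive (n : nat) : (0 < n)%N ->
  [transitive <<[set D_right n; D_up n]>>%g, on [set: 'I_(5 * n)] | 'P].
Proof.
rewrite /D_right => n0; set c := flatten _.
have mc y : reflect (exists2 k, (0 < k <= n)%N &
    y \in [:: 5 * k - 4; 5 * k - 3; 5 * k - 2]%N) (y \in c).
  apply: (iffP flatten_mapP) => [[k]|[k kn yk]]; last first.
    by exists k => //; rewrite mem_iota; lia.
  by rewrite mem_iota => kn yk; exists k => //; lia.
apply: transitive_cyc => //.
- have pw m : forall i, (0 < i)%N -> pairwise ltn
      (flatten [seq [:: 5 * k - 4; 5 * k - 3; 5 * k - 2]%N | k <- iota i m]).
    elim: m => [|m IHm] i i0 //.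
    have H y : (y <= 5 * i)%N -> all (ltn y) (flatten
        [seq [:: 5 * k - 4; 5 * k - 3; 5 * k - 2]%N | k <- iota i.+1 m]).
      move=> yi; apply/allP => z /flatten_mapP[k]; rewrite mem_iota !inE.
      by move=> ki /or3P[] /eqP ->; lia.
    by rewrite /= !H ?IHm ?andbT //; lia.
  by apply: (pairwise_uniq ltnn); apply: pw.
- apply/negP => /eqP c0; have : 1%N \in c; last by rewrite c0.
  by apply/mc; exists 1%N.
- by apply/allP => y /mc[k kn]; rewrite !inE => /or3P[] /eqP ->; lia.
move=> x; have xn := ltn_ord x.
have [/mc xc|xc] := boolP (x.+1 \in c).
  by exists x; [apply/mc | apply: Or31].
pose k := (x %/ 5).+1.
have xk : (x.+1 = 5 * k - 1)%N \/ (x.+1 = 5 * k)%N.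
  have: ~~ (x.+1 \in [:: 5 * k - 4; 5 * k - 3; 5 * k - 2]%N).
    by apply: contra xc => xk; apply/mc; exists k => //; lia.
  by rewrite !inE /k; lia.
have upE (z : 'I_(5 * n)) : z.+1 \in [:: 5 * k - 4; 5 * k - 1]%N ->
    (D_up n z).+1 = next [:: 5 * k - 4; 5 * k - 1; 5 * k]%N z.+1.
  move=> zk; rewrite /D_up permM; set w := (X in (nat_of_ord (fun_of_perm _ X)).+1 = _).
  have wE : w.+1 = next [:: 5 * k - 4; 5 * k - 1; 5 * k]%N z.+1.
    rewrite /w (@prod_cyc_val _ _ _ k) ?iota_uniq //=.
    - by move=> i; rewrite mem_index_iota /= !inE; lia.
    - move=> i j; rewrite !mem_index_iota => ? ? y; rewrite !inE.
      by lia.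
    - by rewrite mem_index_iota; lia.
    - by move: zk; rewrite !inE; lia.
  rewrite prod_cyc_id //.
    by move=> i; rewrite mem_index_iota /= !inE; lia.
  move=> i; rewrite mem_index_iota => ikn.
  have : w.+1 \in [:: 5 * k - 4; 5 * k - 1; 5 * k]%N.
    by rewrite wE mem_next; move: zk; rewrite !inE; lia.
  by rewrite !inE; lia.
have yd : (5 * k - 5 < 5 * n)%N by lia.
pose y := Ordinal yd.
have yE : y.+1 = (5 * k - 4)%N by rewrite /=; lia.
exists y; first by apply/mc; exists k; rewrite ?inE /=; lia.
have byE : (D_up n y).+1 = (5 * k - 1)%N.
  by rewrite upE yE ?inE ?eqxx //= eqxx.
case: xk => xE; [apply: Or32 | apply: Or33]; apply/val_inj/succn_inj.
  by rewrite byE.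
rewrite upE byE ?inE ?eqxx ?orbT //= xE ifN ?eqxx //.
by lia.
Qed.

(* Only the O_n with n >= 1 are origamis: degree 0 is not connected. *)
Definition L23_origami (n : nat) (hn : (0 < n)%N) : origami :=
  Origami (L23_transitive hn).

Definition D_origami (n : nat) (hn : (0 < n)%N) : origami :=
  Origami (D_transitive hn).

Local Open Scope classical_set_scope.
Local Open Scope ring_scope.

Section TranslationSurface.
Context {R : realType}.

Definition xco (z : 'cV[R]_2) : R := z 0 0.
Definition yco (z : 'cV[R]_2) : R := z 1 0.
Definition e1 : 'cV[R]_2 := delta_mx 0 0.
Definition e2 : 'cV[R]_2 := delta_mx 1 0.

Definition half_open_square (z : 'cV[R]_2) : bool :=
  [&& 0 <= xco z < 1, 0 <= yco z < 1 & z != 0].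

(* The punctured surface X^*.  After gluing, every point of X^* lies in exactly
   one half-open square [0, 1[ x [0, 1[ minus its lower left vertex, so that X^*
   is the set of pairs (i, z) with i a square and z a point of that region.  The
   covering p sends (i, z) to the class of z. *)
Definition surface (O : origami) : Type :=
  {p : 'I_(degree O) * 'cV[R]_2 | half_open_square p.2}.

Definition square {O} (P : surface O) : 'I_(degree O) := (sval P).1.
Definition pos {O} (P : surface O) : 'cV[R]_2 := (sval P).2.

(* An atlas of the translation structure of X^*; all charts lift (inverses of)
   the projection C -> E, hence the transition maps are local translations.
   - Inner i: the open square i, with image ]0, 1[ x ]0, 1[;
   - RightEdge i: the open right half of square i, its open right edge and the
     open left half of square [glue_right i], with image ]1/2, 3/2[ x ]0, 1[;
   - UpperEdge i: the open upper half of square i, its open upper edge and the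
     open lower half of square [glue_up i], with image ]0, 1[ x ]1/2, 3/2[.
   Taking halves keeps the charts injective when [glue_right i = i] or
   [glue_up i = i]. *)
Inductive chart (O : origami) : Type :=
| Inner of 'I_(degree O)
| RightEdge of 'I_(degree O)
| UpperEdge of 'I_(degree O).

Definition chart_dom {O} (c : chart O) : set (surface O) :=
  match c with
  | Inner i => [set P | [/\ square P = i, 0 < xco (pos P) & 0 < yco (pos P)]]
  | RightEdge i =>
      [set P | 0 < yco (pos P) /\
         ((square P = i /\ 2^-1 < xco (pos P)) \/
          (square P = glue_right O i /\ xco (pos P) < 2^-1))]
  | UpperEdge i =>
      [set P | 0 < xco (pos P) /\
         ((square P = i /\ 2^-1 < yco (pos P)) \/
          (square P = glue_up O i /\ yco (pos P) < 2^-1))]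
  end.

(* Only meaningful on [chart_dom c]. *)
Definition chart_map {O} (c : chart O) (P : surface O) : 'cV[R]_2 :=
  match c with
  | Inner _ => pos P
  | RightEdge _ => if xco (pos P) < 2^-1 then pos P + e1 else pos P
  | UpperEdge _ => if yco (pos P) < 2^-1 then pos P + e2 else pos P
  end.

(* f has the form z |-> A z + z0 in local charts, A not depending on the charts:
   near chart_map c P, the map (chart_map c') \o f \o (chart_map c)^-1 is defined
   and equal to z |-> A z + z0. *)
Definition locally_affine {O} (A : 'M[R]_2) (f : surface O -> surface O) : Prop :=
  forall (c c' : chart O) (P : surface O),
    chart_dom c P -> chart_dom c' (f P) ->
    exists z0 : 'cV[R]_2, \forall z \near chart_map c P,
      forall Q : surface O, chart_dom c Q -> chart_map c Q = z ->
        chart_dom c' (f Q) /\ chart_map c' (f Q) = A *m z + z0.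

(* A bijection which is z |-> A z + z0 in charts with A invertible is a
   diffeomorphism, and it preserves the orientation iff 0 < \det A. *)
Definition affine_diffeo {O} (A : 'M[R]_2) (f : surface O -> surface O) : Prop :=
  [/\ bijective f, 0 < \det A & locally_affine A f].

Definition Veech_group (O : origami) : set 'M[R]_2 :=
  [set A | exists f : surface O -> surface O, affine_diffeo A f].

(* Subgroups of SL_2(Z), seen as sets of real matrices. *)
Definition SL2Z : set 'M[R]_2 :=
  [set map_mx intr B | B in [set B : 'M[int]_2 | \det B = 1]].

Definition subgroup_SL2Z (G : set 'M[R]_2) : Prop :=
  [/\ G `<=` SL2Z, G 1%:M,
      forall A B, G A -> G B -> G (A *m B)
    & forall A, G A -> G (invmx A)].

Definition principal_congruence (n : nat) : set 'M[R]_2 :=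
  [set map_mx intr B | B in [set B : 'M[int]_2 | \det B = 1 /\
     forall i j, (B i j = (1%:M : 'M[int]_2) i j %[mod n%:Z])%Z]].

Definition congruence_group (G : set 'M[R]_2) : Prop :=
  subgroup_SL2Z G /\ exists n : nat, (0 < n)%N /\ principal_congruence n `<=` G.

Definition noncongruence_group (G : set 'M[R]_2) : Prop :=
  subgroup_SL2Z G /\ ~ congruence_group G.

End TranslationSurface.

Arguments surface R O : clear implicits.
Arguments Veech_group R O : clear implicits.

(* Main.v *)
Require Import Defs.
From HB Require Import structures.
From mathcomp Require Import all_boot all_order all_algebra all_fingroup.
From mathcomp Require Import all_classical all_reals all_analysis.
From mathcomp Require Import zify ring lra.

(* An affine diffeomorphism f of X^* sends the sides of the squares to segments
   joining punctures, because f is proper; hence its derivative A is integral, and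
   in each square f is z |-> A z modulo Z^2.  In particular a map with derivative 1
   just permutes the squares, by a permutation intertwining the gluings.

   O_m is a cyclic cover of O_n for n | m, and every translation automorphism of
   O_m is a deck transformation over O_1.  So an affine diffeomorphism normalizes
   the cyclic deck group; it preserves the subgroup of order m/n, and descends to
   O_n.

   With T = (1 1; 0 1), untwisting an affine diffeomorphism of derivative T^k
   yields a permutation commuting with sigma_a and conjugating sigma_b twisted by
   sigma_a^-k to sigma_b.  Such a permutation is a deck transformation, so
   sigma_a^k = 1: T^k lies in Gamma(O_n) iff 3n | k.  This tells the groups
   Gamma(O_n) apart.

   Finally Gamma(O_1) contains T^3 and the fourth powers of the parabolic matrices
   V and W fixing (1, 1) and (2, 1), where T = V W V^-1.  Since 3 is odd and 4 is a
   power of 2, any Gamma(N) together with these generates T itself, which is not in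
   Gamma(O_1). *)

Set Implicit Arguments.
Unset Strict Implicit.
Unset Printing Implicit Defensive.

Import Order.TTheory GRing.Theory Num.Theory.
Import numFieldNormedType.Exports.

(** * Gluings lifted to the natural numbers *)

(** The exponent 4 comes from the two origamis O_1: in both, sigma_b sigma_a and sigma_a sigma_b
    sigma_a have order 4. These are horizontal gluings of O_1 after changes of basis sending (1, 0)
    to (1, 1) and (2, 1), so they control the powers of V and W just as the order 3 of sigma_a
    controls those of T. The obstacle is that an affine diffeomorphism is known only through charts,
    while everything else is about permutations. The relation [nbr] forgets the charts, and modulo
    Z^2 it sees only E; inside a square f is z |-> A z + v with v constant modulo Z^2. If the value
    at a vertex were not in Z^2, the inverse of f would stay away from the punctures near that
    value, although it takes points arbitrarily close to the value to points arbitrarily close to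
    the vertex. What makes deck transformations the only intertwiners is a chain of squares fixed by
    sigma_a that sigma_b leads into the long cycle: one square per block for L(2,3), two for D. *)

(* F and G are the lifts to nat of sigma_a and sigma_b (labels shifted to start
   at 0), l is the degree of O_1.  The block of 0 splits into the F-orbit
   0, F 0, F (F 0) and the squares x0, G x0, ... (c of them) fixed by F. *)
Record staircase (l : nat) (F G : nat -> nat) (c x0 : nat) : Prop := Staircase {
  stair_gt0 : (0 < l)%N;
  stairF : forall x, F (x + l)%N = (F x + l)%N;
  stairG : forall x, G (x + l)%N = (G x + l)%N;
  stair_residue : forall x, (x < l)%N ->
    (exists2 i, (i < 3)%N & x = iter i F 0%N) \/ (exists2 i, (i < c)%N & x = iter i G x0);
  stair_orbit : [/\ (0 < F 0 < l)%N, (0 < F (F 0) < l)%N & F (F (F 0)) = l];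
  stair_fixed : forall i, (i < c)%N -> F (iter i G x0) = iter i G x0;
  stair_chain : iter c G x0 = 0%N;
  stair_uniq : forall x, (forall i, (i < c)%N -> F (iter i G x) = iter i G x) ->
    (x %% l = x0)%N;
  stair_mod : forall x, F x = x %[mod l] -> F x = x
}.

Definition lifts (d : nat) (F : nat -> nat) (a : 'S_d) : Prop :=
  forall x : 'I_d, a x = F x %% d :> nat.

Section Staircase.
Variables (l : nat) (F G : nat -> nat) (c x0 : nat).
Hypothesis st : staircase l F G c x0.

Lemma shift_mul (H : nat -> nat) : (forall x, H (x + l)%N = (H x + l)%N) ->
  forall x j, H (x + l * j)%N = (H x + l * j)%N.
Proof.
move=> HS x; elim=> [|j IHj]; first by rewrite muln0 !addn0.
by rewrite mulnS (addnC l) addnA HS IHj addnA.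
Qed.

Lemma iter_shift (H : nat -> nat) : (forall x, H (x + l)%N = (H x + l)%N) ->
  forall i x j, iter i H (x + l * j)%N = (iter i H x + l * j)%N.
Proof. by move=> HS i x j; elim: i => //= i ->; apply: shift_mul. Qed.

(** Three steps of [F] from 0 climb exactly one block; modulo [l * n] this puts 0 on a cycle of
    length 3n. *)
Lemma iterF3 j : iter (3 * j) F 0 = (l * j)%N.
Proof.
have [_ _ F3] := stair_orbit st.
elim: j => [|j IHj]; first by rewrite !muln0.
rewrite mulnS iterD IHj -{1}[(l * j)%N]add0n iter_shift; last exact: stairF st.
by rewrite /= F3 mulnS.
Qed.

Section Perm.
Variables (n : nat) (d : nat).
Hypotheses (n0 : (0 < n)%N) (dE : d = (l * n)%N).

Let d0 : (0 < d)%N. Proof. by rewrite dE muln_gt0 n0 (stair_gt0 st). Qed.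

Definition res (x : nat) : 'I_d := Ordinal (ltn_pmod x d0).

Lemma resK (x : 'I_d) : res x = x.
Proof. by apply/val_inj; rewrite /= modn_small. Qed.

Lemma res_eq x y : x = y %[mod d] <-> res x = res y.
Proof. by split=> [h|[]//]; apply/val_inj. Qed.

Lemma lifts_res (H : nat -> nat) (a : 'S_d) : (forall x, H (x + l)%N = (H x + l)%N) ->
  lifts H a -> forall x, a (res x) = res (H x).
Proof.
move=> HS ha x; apply/val_inj; rewrite /= ha /=.
have {2}-> : x = (x %% d + l * (n * (x %/ d)))%N.
  by rewrite mulnA -dE mulnC addnC -divn_eq.
by rewrite shift_mul // mulnA -dE addnC mulnC modnMDl.
Qed.

Lemma iter_res (H : nat -> nat) (a : 'S_d) : (forall x, H (x + l)%N = (H x + l)%N) ->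
  lifts H a -> forall i x, iter i a (res x) = res (iter i H x).
Proof. by move=> HS ha i x; elim: i => //= i ->; apply: lifts_res. Qed.

Variables (a b : 'S_d).
Hypotheses (ha : lifts F a) (hb : lifts G b).

Let aE := lifts_res (stairF st) ha.
Let bE := lifts_res (stairG st) hb.
Let iaE := iter_res (stairF st) ha.
Let ibE := iter_res (stairG st) hb.

Lemma res_mod_l x y : res x = res y -> x = y %[mod l].
Proof.
move/res_eq=> h; have := congr1 (fun z => z %% l)%N h.
by rewrite /= dE !modn_dvdm // dvdn_mulr.
Qed.

Lemma residueP (x : 'I_d) : exists j,
  (exists2 i, (i < 3)%N & x = res (iter i F 0 + l * j)) \/
  (exists2 i, (i < c)%N & x = res (iter i G x0 + l * j)).
Proof.
exists (x %/ l)%N.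
have := stair_residue st (ltn_pmod x (stair_gt0 st)).
by case=> -[i ic E]; [left|right]; exists i => //; rewrite -E addnC mulnC -divn_eq resK.
Qed.

Lemma residue_orbit i j : res (iter i F 0 + l * j) = iter i a (res (l * j)).
Proof. by rewrite iaE -(iter_shift (stairF st)) add0n. Qed.

Lemma residue_chain i j : res (iter i G x0 + l * j) = iter i b (res (x0 + l * j)).
Proof. by rewrite ibE -(iter_shift (stairG st)). Qed.

Lemma fixed_res i j : (i < c)%N -> a (res (iter i G x0 + l * j)) = res (iter i G x0 + l * j).
Proof. by move=> ic; rewrite aE (shift_mul (stairF st)) (stair_fixed st). Qed.

Lemma order_dvd k : (forall x, iter k a x = x) <-> (3 * n %| k)%N.
Proof.
have [/andP[h1 h1'] /andP[h2 h2'] h3] := stair_orbit st.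
split=> [H|/dvdnP[q ->] x].
  have := H (res 0); rewrite iaE (divn_eq k 3) addnC mulnC iterD iterF3.
  rewrite -[(l * _)%N]add0n (iter_shift (stairF st)) => h.
  (* [F 0] and [F (F 0)] lie strictly between 0 and [l], so only a multiple of 3 steps returns to
     residue 0. *)
  have r0 : (k %% 3 = 0)%N.
    have := res_mod_l h; rewrite addnC mulnC modnMDl mod0n.
    have : (k %% 3 < 3)%N by rewrite ltn_mod.
    by case: (k %% 3)%N => [|[|[|//]]] //= _; rewrite modn_small // => E; lia.
  move: h; rewrite r0 /= add0n => /res_eq; rewrite mod0n dE -muln_modr => /eqP.
  rewrite muln_eq0 => /orP[|nq]; first by have := stair_gt0 st; lia.
  by rewrite add0n dvdn_mul.
have [j [] [i ic ->]] := residueP x.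
  rewrite residue_orbit -!iterD addnC iterD; congr iter.
  rewrite iaE -[(l * j)%N]add0n (iter_shift (stairF st)) (mulnC q) -mulnA iterF3.
  by apply/res_eq; rewrite mulnA -dE mulnC modnMDl.
by elim: (q * _)%N => //= m ->; apply: fixed_res.
Qed.

(* Squares fixed by sigma_a do not feel the twist sigma_a^-k, so p maps each chain
   x0, G x0, ..., G^c x0 = 0 to such a chain; this pins down p. *)
Lemma intertwiner_translation (k : nat) (p : 'I_d -> 'I_d) :
  (forall x, p (a x) = a (p x)) -> (forall x, p ((a ^- k * b)%g x) = b (p x)) ->
  exists s, forall x, p (res x) = res (x + l * s).
Proof.
move=> pa pb.
have pia i x : p (iter i a x) = iter i a (p x) by elim: i => //= i <-.
have pb_fix x : a x = x -> p (b x) = b (p x).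
  move=> ax; rewrite -pb permM; congr (p (b _)).
  apply: (@perm_inj _ (a ^+ k)%g); rewrite permKV permX.
  by elim: (k) => //= m ->.
have chain j i : (i <= c)%N ->
    p (res (iter i G x0 + l * j)) = iter i b (p (res (x0 + l * j))).
  elim: i => [|i IHi] ic; first by [].
  rewrite [RHS]iterS -(IHi (ltnW ic)) -(pb_fix _ (fixed_res j ic)) bE iterS.
  by rewrite (shift_mul (stairG st)).
(* Being fixed by sigma_a is only a congruence for the lifts; [stair_mod] makes it an equality, to
   which [stair_uniq] applies. *)
have fixed_multiple (u : 'I_d) : (forall i, (i < c)%N -> a (iter i b u) = iter i b u) ->
    exists m, u = res (x0 + l * m).
  move=> ub; exists (u %/ l)%N.
  have <- : (u %% l = x0)%N.
    apply: (stair_uniq st) => i /ub; rewrite -[u in iter i b u]resK ibE aE => E.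
    by apply: (stair_mod st); apply: res_mod_l.
  by rewrite addnC mulnC -divn_eq resK.
have chainm j : exists m, p (res (x0 + l * j)) = res (x0 + l * m).
  apply: fixed_multiple => i ic.
  by rewrite -(chain j i (ltnW ic)) -pa (fixed_res j ic).
have cG j : res (iter c G x0 + l * j) = res (l * j) by rewrite (stair_chain st) add0n.
have [s hs] := chainm 0%N; exists s.
(* The chain ends at 0, on the long cycle, so its image determines [p] at 0; commuting with sigma_a
   then gives [p] along the whole cycle. *)
have p0 : p (res 0) = res (l * s).
  by rewrite -(muln0 l) -[in LHS]cG (chain _ _ (leqnn c)) hs -residue_chain cG.
have pl j : p (res (l * j)) = res (l * s + l * j).
  by rewrite -[(l * j)%N]iterF3 -iaE pia p0 iaE -[(l * s)%N]add0n
    (iter_shift (stairF st)) iterF3 addnC.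
have H y : exists2 x, y = res x & p y = res (x + l * s).
  have [j [] [i ic ->]] := residueP y.
    exists (iter i F 0 + l * j)%N => //.
    rewrite residue_orbit pia pl iaE -[(l * s + _)%N]add0n -mulnDr (iter_shift (stairF st)).
    by rewrite mulnDr -addnA (addnC (l * s)%N).
  exists (iter i G x0 + l * j)%N => //.
  have [m hm] := chainm j; rewrite (chain _ _ (ltnW ic)) hm -residue_chain.
  (* A priori the chain of block j goes to an arbitrary block m. Its end [l * j] is on the long
     cycle, where [p] is known, and this forces m = s + j modulo n. *)
  have : res (l * m) = res (l * s + l * j)
    by rewrite -pl -cG -[in RHS]cG (chain _ _ (leqnn c)) hm residue_chain.
  move/res_eq => E; apply/res_eq; apply/eqP.
  by rewrite -addnA eqn_modDl (addnC (l * j)%N); apply/eqP.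
move=> x; have [z /res_eq xz ->] := H (res x).
by apply/res_eq/eqP; rewrite eqn_modDr; apply/eqP.
Qed.

(** A shift by whole blocks commutes with sigma_b as well. Comparing with the twisted relation and
    cancelling [p] and sigma_b leaves sigma_a^k = 1. *)
Lemma twist_order (k : nat) (p : 'I_d -> 'I_d) :
  (forall x, p (a x) = a (p x)) -> (forall x, p ((a ^- k * b)%g x) = b (p x)) ->
  (3 * n %| k)%N.
Proof.
move=> pa pb; have [s hs] := intertwiner_translation pa pb.
apply/order_dvd => y; rewrite -permX.
have := pb ((a ^+ k)%g y); rewrite permM permK.
have p_b x : p (b x) = b (p x).
  rewrite -[x]resK bE !hs bE; congr res.
  by rewrite (shift_mul (stairG st)).
rewrite -p_b => E; apply: (@perm_inj _ b); apply/esym; move: E.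
rewrite -[b y]resK -[b (_ y)]resK !hs => /res_eq/eqP; rewrite eqn_modDr => /eqP.
by move/res_eq.
Qed.

End Perm.
End Staircase.

(** * Explicit lifts of the gluings of the two sequences *)

Lemma flatten_blocks (B : nat -> seq nat) (n : nat) : (forall k, size (B k) = 3) ->
  flatten [seq B k | k <- iota 1 n] =
  mkseq (fun i => nth 0 (B (i %/ 3).+1) (i %% 3)) (3 * n).
Proof.
move=> B3; pose f i := nth 0 (B (i %/ 3).+1) (i %% 3).
rewrite -[mkseq _ _]/(mkseq f (3 * n)).
have fE m i : i < 3 -> f (3 * m + i) = nth 0 (B m.+1) i.
  move=> i3; rewrite /f; have [-> ->] : (3 * m + i) %/ 3 = m /\ (3 * m + i) %% 3 = i by lia.
  by [].
clearbody f; elim: n => [|n IHn]; first by rewrite muln0.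
rewrite -[n.+1]addn1 iotaD map_cat flatten_cat IHn mulnDr /mkseq (iotaD 0) map_cat.
congr (_ ++ _); rewrite add0n /= cats0 -(addn0 (3 * n)) -!addnS !fE // add1n.
by case: (B _) (B3 n.+1) => [|u1 [|u2 [|u3 [|]]]].
Qed.

Lemma next_mkseq (T : eqType) (f : nat -> T) (N i : nat) :
  uniq (mkseq f N) -> i < N -> next (mkseq f N) (f i) = f (i.+1 %% N).
Proof.
case: N => // N Uf iN.
have iE : index (f i) (mkseq f N.+1) = i.
  by rewrite -[in LHS](nth_mkseq (f 0) f iN) index_uniq ?size_mkseq.
have fin : f i \in mkseq f N.+1.
  by rewrite -(nth_mkseq (f 0) f iN) mem_nth ?size_mkseq.
rewrite next_nth fin iE /mkseq /= -/(mkseq f N.+1).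
rewrite -[nth _ _ i]/(nth (f 0) (mkseq f N.+1) i.+1).
move: iN; rewrite ltnS leq_eqVlt => /orP[/eqP ->|iN].
  by rewrite modnn nth_default ?size_mkseq.
by rewrite nth_mkseq ?modn_small.
Qed.

Section Sweep.
Variables (l n r1 r2 : nat).
Hypotheses (r1r2 : 0 < r1 < r2) (r2l : r2 < l).

Let r i := nth 0 [:: 0; r1; r2] i.
Let f i := (l * (i %/ 3) + r (i %% 3)).+1.
Let c := mkseq f (3 * n).

Let r_lt i : i < 3 -> r i < l.
Proof. by rewrite /r; case: i => [|[|[|//]]] _ /=; lia. Qed.

Let divl q s : s < l -> (l * q + s) %/ l = q /\ (l * q + s) %% l = s.
Proof.
move=> sl; have l0 : 0 < l by lia.
by rewrite mulnC divnMDl // modnMDl divn_small // modn_small // addn0.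
Qed.

Let f_inj : injective f.
Proof.
move=> i j [] E.
have h i' : i' %% 3 < 3 by rewrite ltn_mod.
have [q1 s1] := divl (i %/ 3) (r_lt (h i)); have [q2 s2] := divl (j %/ 3) (r_lt (h j)).
have qE : i %/ 3 = j %/ 3 by rewrite -q1 -q2 E.
have sE : r (i %% 3) = r (j %% 3) by rewrite -s1 -s2 E.
suff rE : i %% 3 = j %% 3 by rewrite (divn_eq i 3) (divn_eq j 3) qE rE.
move: (h i) (h j) sE.
by case: (i %% 3) => [|[|[|//]]]; case: (j %% 3) => [|[|[|//]]] //=; rewrite /r /=; lia.
Qed.

(** Serves both sequences: (l, r1, r2) is (4, 2, 3) for L(2,3) and (5, 1, 2) for D. After the
    residues 0, r1, r2 of one block the cycle enters the next block; reduction modulo [l * n] closes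
    it up. *)
Lemma cyc_sweep (x : 'I_(l * n)) : cyc (l * n) c x =
  (if x %% l == 0 then x + r1 else if x %% l == r1 then x + (r2 - r1)
   else if x %% l == r2 then x + (l - r2) else x) %% (l * n) :> nat.
Proof.
have Uc : uniq c by rewrite mkseq_uniq.
have l0 : 0 < l by lia.
have xn := ltn_ord x; have qn : x %/ l < n by rewrite ltn_divLR // (mulnC n).
have fE i : i < 3 -> f (3 * (x %/ l) + i) = (l * (x %/ l) + r i).+1.
  by move=> i3; rewrite /f; congr (_ * _ + r _).+1; lia.
have rc : all (fun k => 0 < k <= l * n) c.
  apply/allP => y /mapP[i]; rewrite mem_iota /= => iN ->; rewrite /f /=.
  have h : i %% 3 < 3 by rewrite ltn_mod.
  have q : (i %/ 3).+1 <= n by lia.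
  by apply: leq_trans (leq_mul (leqnn l) q); rewrite mulnS addnC ltn_add2r r_lt.
have xE : x = l * (x %/ l) + x %% l :> nat by rewrite (mulnC l (x %/ l)) -divn_eq.
have step i : i < 3 -> x %% l = r i ->
    (cyc (l * n) c x).+1 = f ((3 * (x %/ l) + i).+1 %% (3 * n)).
  move=> i3 xr; rewrite cyc_val // -next_mkseq //; last lia.
  by congr next; rewrite fE // -xr -xE.
have fS i : i < 2 -> f ((3 * (x %/ l) + i).+1 %% (3 * n)) = (l * (x %/ l) + r i.+1).+1.
  by move=> i2; rewrite modn_small -?addnS ?fE //; lia.
have small s : s < l -> l * (x %/ l) + s < l * n.
  move=> sl; apply: leq_trans (leq_mul (leqnn l) qn).
  by rewrite mulnS addnC ltn_add2r.
case: eqVneq => [x0|n0].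
  have := step 0 isT x0; rewrite fS // => -[->].
  by rewrite [in RHS]xE x0 addn0 modn_small ?small //=; lia.
case: eqVneq => [x1|n1].
  have := step 1 isT x1; rewrite fS // => -[->].
  by rewrite [in RHS]xE x1 -addnA subnKC ?modn_small ?small //; lia.
case: eqVneq => [x2|n2].
  rewrite [in RHS]xE x2 -addnA subnKC ?(ltnW r2l) // addnC -mulnS.
  have := step 2 isT x2; move: (nat_of_ord (cyc _ _ _)) (x %/ l) qn => v q.
  rewrite leq_eqVlt => /orP[/eqP E|qn].
    rewrite -E (_ : (3 * q + 2).+1 = 3 * q.+1); last lia.
    by rewrite !modnn => -[->]; rewrite /r /= muln0.
  rewrite modn_small; last lia.
  have [E1 E2] : (3 * q + 2).+1 %/ 3 = q.+1 /\ (3 * q + 2).+1 %% 3 = 0 by lia.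
  by rewrite /f E1 E2 => -[->]; rewrite modn_small ?ltn_pmul2l // addn0.
rewrite modn_small //; apply: succn_inj; rewrite cyc_val // next_nth ifN //.
apply/negP => /mapP[i _ []] xi.
have h : i %% 3 < 3 by rewrite ltn_mod.
have [_] := divl (i %/ 3) (r_lt h); rewrite -xi => E.
rewrite E in n0 n1 n2; move: h n0 n1 n2 {E xi}.
by case: (i %% 3) => [|[|[|//]]] _; rewrite /r /= ?eqxx.
Qed.

End Sweep.

Definition L23_F (x : nat) : nat := x + nth 0 [:: 2; 0; 1; 1] (x %% 4).
Definition L23_G (x : nat) : nat :=
  if x %% 4 == 0 then x.+1 else if x %% 4 == 1 then x.-1 else x.
Definition D_F (x : nat) : nat := x + nth 0 [:: 1; 1; 3; 0; 0] (x %% 5).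
Definition D_G (x : nat) : nat :=
  if x %% 5 == 0 then x + 3 else if x %% 5 == 1 then x.+1 else
  if x %% 5 == 2 then x.-1 else if x %% 5 == 3 then x.+1 else x - 4.

(** In the block of 0, only square 1 is fixed by sigma_a, and sigma_b takes it to 0. *)
Lemma L23_staircase : staircase 4 L23_F L23_G 1 1.
Proof.
have FE x : L23_F x = if x %% 4 == 0 then x + 2 else if x %% 4 == 1 then x else x.+1.
  rewrite /L23_F; have : x %% 4 < 4 by rewrite ltn_mod.
  by case: (x %% 4) => [|[|[|[|//]]]] _ /=; lia.
split=> //.
- by move=> x; rewrite /L23_F modnDr addnAC.
- by move=> x; rewrite /L23_G modnDr; do !case: eqP; lia.
- case=> [|[|[|[|//]]]] _;
    by [left; exists 0|right; exists 0|left; exists 1|left; exists 2].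
- by case.
- by move=> x /(_ 0 isT) /=; rewrite FE; do !case: eqP; lia.
- by move=> x /=; rewrite FE; do !case: eqP; lia.
Qed.

(** Squares 3 and 4 are fixed by sigma_a, and sigma_b runs through 3, 4, 0. Two conditions single
    out 3: the successor of 4 is 0, which sigma_a moves. *)
Lemma D_staircase : staircase 5 D_F D_G 2 3.
Proof.
have FE x : D_F x = if x %% 5 < 2 then x.+1 else if x %% 5 == 2 then x + 3 else x.
  rewrite /D_F; have : x %% 5 < 5 by rewrite ltn_mod.
  by case: (x %% 5) => [|[|[|[|[|//]]]]] _ /=; lia.
split=> //.
- by move=> x; rewrite /D_F modnDr addnAC.
- by move=> x; rewrite /D_G modnDr; do !case: eqP; lia.
- case=> [|[|[|[|[|//]]]]] _;
    by [left; exists 0|left; exists 1|left; exists 2|right; exists 0|right; exists 1].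
- by case=> [|[]].
- move=> x h; have := h 0 isT; have := h 1 isT; rewrite /= !FE /D_G.
  by do !case: ifP; lia.
- by move=> x /=; rewrite FE; do !case: ifP; lia.
Qed.

Lemma L23_right_lifts n : lifts L23_F (L23_right n).
Proof.
move=> x; rewrite /L23_right flatten_blocks //.
rewrite (_ : mkseq _ _ =
    mkseq (fun i => (4 * (i %/ 3) + nth 0 [:: 0; 2; 3] (i %% 3)).+1) (3 * n)).
  rewrite cyc_sweep //; congr (_ %% _); rewrite /L23_F.
  have : x %% 4 < 4 by rewrite ltn_mod.
  by case: (x %% 4) => [|[|[|[|//]]]] _ //=; lia.
apply: eq_map => i; have : i %% 3 < 3 by rewrite ltn_mod.
by case: (i %% 3) => [|[|[|//]]] _ /=; lia.
Qed.

Lemma D_right_lifts n : lifts D_F (D_right n).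
Proof.
move=> x; rewrite /D_right flatten_blocks //.
rewrite (_ : mkseq _ _ =
    mkseq (fun i => (5 * (i %/ 3) + nth 0 [:: 0; 1; 2] (i %% 3)).+1) (3 * n)).
  rewrite cyc_sweep //; congr (_ %% _); rewrite /D_F.
  have : x %% 5 < 5 by rewrite ltn_mod.
  by case: (x %% 5) => [|[|[|[|[|//]]]]] _ //=; lia.
apply: eq_map => i; have : i %% 3 < 3 by rewrite ltn_mod.
by case: (i %% 3) => [|[|[|//]]] _ /=; lia.
Qed.

Lemma L23_up_lifts n : lifts L23_G (L23_up n).
Proof.
move=> x; have xn := ltn_ord x; rewrite /L23_up.
have rE : {in index_iota 1 n.+1, forall k, uniq [:: 4 * k - 3; 4 * k - 2] &&
    all (fun k => 0 < k <= 4 * n) [:: 4 * k - 3; 4 * k - 2]}.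
  by move=> k; rewrite mem_index_iota /= inE; lia.
apply: succn_inj; rewrite /L23_G.
have [x1|x1] := ltnP 1 (x %% 4).
  rewrite prod_cyc_id //; last by move=> k; rewrite mem_index_iota !inE; lia.
  by do !case: eqP => ?; rewrite ?modn_small; lia.
rewrite (@prod_cyc_val _ _ _ (x %/ 4).+1) ?iota_uniq //=.
- by do !case: eqP => ?; rewrite ?modn_small; lia.
- by move=> i j; rewrite !mem_index_iota => ? ? y; rewrite !inE; lia.
- by rewrite mem_index_iota; lia.
- by rewrite !inE; lia.
Qed.

Lemma D_up_lifts n : lifts D_G (D_up n).
Proof.
move=> x; have xn := ltn_ord x; rewrite /D_up permM.
have r1 : {in index_iota 1 n.+1, forall k, uniq [:: 5 * k - 4; 5 * k - 1; 5 * k] &&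
    all (fun k => 0 < k <= 5 * n) [:: 5 * k - 4; 5 * k - 1; 5 * k]}.
  by move=> k; rewrite mem_index_iota /= !inE; lia.
have r2 : {in index_iota 1 n.+1, forall k, uniq [:: 5 * k - 3; 5 * k - 2] &&
    all (fun k => 0 < k <= 5 * n) [:: 5 * k - 3; 5 * k - 2]}.
  by move=> k; rewrite mem_index_iota /= !inE; lia.
have d1 : {in index_iota 1 n.+1 &, forall k l y, y \in [:: 5 * k - 4; 5 * k - 1; 5 * k] ->
    y \in [:: 5 * l - 4; 5 * l - 1; 5 * l] -> k = l}.
  by move=> i j; rewrite !mem_index_iota => ? ? y; rewrite !inE; lia.
have d2 : {in index_iota 1 n.+1 &, forall k l y, y \in [:: 5 * k - 3; 5 * k - 2] ->
    y \in [:: 5 * l - 3; 5 * l - 2] -> k = l}.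
  by move=> i j; rewrite !mem_index_iota => ? ? y; rewrite !inE; lia.
have kn : (x %/ 5).+1 \in index_iota 1 n.+1 by rewrite mem_index_iota; lia.
apply: succn_inj; rewrite /D_G.
(* Residues 1 and 2 are moved by the transpositions only, the others by the 3-cycles only. *)
have [x12|x12] := boolP ((x %% 5 == 1) || (x %% 5 == 2)).
  rewrite (prod_cyc_id (x := x) r1); last by move=> k; rewrite mem_index_iota !inE; lia.
  rewrite (prod_cyc_val (iota_uniq _ _) r2 d2 kn) /=; last by rewrite !inE; lia.
  by do !case: eqP => ?; rewrite ?modn_small; lia.
set w := (X in fun_of_perm _ X).
have wE : w.+1 = next [:: 5 * (x %/ 5).+1 - 4; 5 * (x %/ 5).+1 - 1; 5 * (x %/ 5).+1] x.+1.
  by rewrite /w (prod_cyc_val (iota_uniq _ _) r1 d1 kn) //= !inE; lia.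
rewrite (prod_cyc_id (x := w) r2).
  by rewrite wE /=; do !case: eqP => ?; rewrite ?modn_small; lia.
move=> k; rewrite mem_index_iota => ?.
have : w.+1 \in [:: 5 * (x %/ 5).+1 - 4; 5 * (x %/ 5).+1 - 1; 5 * (x %/ 5).+1].
  by rewrite wE mem_next !inE; lia.
by rewrite !inE; lia.
Qed.

(** * Charts and small translations *)

Local Open Scope ring_scope.

Lemma det_mx2 (K : comNzRingType) (A : 'M[K]_2) :
  \det A = A 0 0 * A 1 1 - A 0 1 * A 1 0.
Proof.
rewrite (expand_det_row _ 0) !big_ord_recl big_ord0 addr0 /cofactor !det_mx11 !mxE /=.
rewrite (_ : lift 0 0 = 1); last exact/val_inj.
rewrite (_ : lift 1 0 = 0); last exact/val_inj.
by rewrite expr0 expr1 mul1r mulN1r mulrN.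
Qed.

Lemma mulmx2E (K : pzRingType) (n : nat) (A : 'M[K]_2) (B : 'M[K]_(2, n)) i j :
  (A *m B) i j = A i 0 * B 0 j + A i 1 * B 1 j.
Proof.
rewrite mxE !big_ord_recl big_ord0 addr0.
by rewrite (_ : lift 0 0 = 1); last exact/val_inj.
Qed.

Lemma forall_ord2 (P : 'I_2 -> Prop) : P 0 -> P 1 -> forall i, P i.
Proof.
move=> P0 P1 [[|[|//]] h]; [rewrite (_ : Ordinal h = 0)|rewrite (_ : Ordinal h = 1)];
  by [|apply/val_inj].
Qed.

Lemma transpose_transitive (O : origami) :
  [transitive <<[set glue_up O; glue_right O]>>%g, on [set: 'I_(degree O)] | 'P].
Proof. by rewrite finset.setUC; apply: origami_transitive. Qed.

(** Reflection in the diagonal. It reduces upper edges to right edges, and later turns upper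
    triangular matrices into lower triangular ones. *)
Definition transpose (O : origami) : origami := Origami (transpose_transitive O).

Section Surface.
Context {R : realType}.
Implicit Types (O : origami) (x y s t e : R).

Definition col2 x y : 'cV[R]_2 := \col_i (if i == 0 then x else y).

Lemma xco_col2 x y : xco (col2 x y) = x. Proof. by rewrite /xco mxE. Qed.
Lemma yco_col2 x y : yco (col2 x y) = y. Proof. by rewrite /yco mxE. Qed.

Lemma xcoD (u v : 'cV[R]_2) : xco (u + v) = xco u + xco v.
Proof. by rewrite /xco mxE. Qed.

Lemma ycoD (u v : 'cV[R]_2) : yco (u + v) = yco u + yco v.
Proof. by rewrite /yco mxE. Qed.

Lemma cV2P (u v : 'cV[R]_2) : xco u = xco v -> yco u = yco v -> u = v.
Proof. by move=> h0 h1; apply/colP; apply: forall_ord2. Qed.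

Lemma e1E : xco (e1 : 'cV[R]_2) = 1 /\ yco (e1 : 'cV[R]_2) = 0.
Proof. by rewrite /xco /yco !mxE. Qed.

Lemma e2E : xco (e2 : 'cV[R]_2) = 0 /\ yco (e2 : 'cV[R]_2) = 1.
Proof. by rewrite /xco /yco !mxE. Qed.

Lemma cV2_addP (u v : 'cV[R]_2) s t :
  u = v + col2 s t <-> xco u = xco v + s /\ yco u = yco v + t.
Proof.
split=> [->|[hx hy]]; first by rewrite xcoD ycoD xco_col2 yco_col2.
by apply: cV2P; rewrite ?xcoD ?ycoD ?xco_col2 ?yco_col2.
Qed.

Definition in_square x y : bool :=
  [&& 0 <= x < 1, 0 <= y < 1 & (x != 0) || (y != 0)].

Lemma half_open_squareE (z : 'cV[R]_2) :
  half_open_square z = in_square (xco z) (yco z).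
Proof.
rewrite /half_open_square /in_square; congr [&& _, _ & _].
rewrite -negb_and; congr negb; apply/eqP/andP => [->|[/eqP h0 /eqP h1]].
  by rewrite /xco /yco !mxE.
by apply: cV2P; rewrite ?h0 ?h1 /xco /yco !mxE.
Qed.

Definition X {O} (P : surface R O) : R := xco (pos P).
Definition Y {O} (P : surface R O) : R := yco (pos P).

Lemma XYP {O} (P : surface R O) : in_square (X P) (Y P).
Proof. by rewrite -half_open_squareE; case: P. Qed.

Lemma surfaceP {O} (P Q : surface R O) :
  square P = square Q -> X P = X Q -> Y P = Y Q -> P = Q.
Proof.
move=> eS eX eY; have := cV2P eX eY; move: eS {eX eY}.
case: P Q => [[i z] hz] [[j w] hw]; rewrite /square /pos /= => eij ezw.
by subst j w; rewrite (bool_irrelevance hw hz).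
Qed.

Lemma in_square_half_open x y : in_square x y -> half_open_square (col2 x y).
Proof. by rewrite half_open_squareE xco_col2 yco_col2. Qed.

Definition mkpt {O} (i : 'I_(degree O)) x y (h : in_square x y) : surface R O :=
  exist _ (i, col2 x y) (in_square_half_open h).

Lemma mkptE {O} (i : 'I_(degree O)) x y (h : in_square x y) :
  [/\ square (mkpt i h) = i, X (mkpt i h) = x & Y (mkpt i h) = y].
Proof. by rewrite /X /Y /pos /= xco_col2 yco_col2. Qed.

(* Q = P + (s, t) for a small vector (s, t); the last two cases are those
   where P lies on the left (resp. lower) edge and Q on the other side of it. *)
Definition nbr {O} (P : surface R O) s t (Q : surface R O) : Prop :=
  [\/ [/\ square Q = square P, X Q = X P + s & Y Q = Y P + t],
      [/\ glue_right O (square Q) = square P, X P = 0, X Q = 1 + s & Y Q = Y P + t]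
    | [/\ glue_up O (square Q) = square P, Y P = 0, X Q = X P + s & Y Q = 1 + t]].

Definition small e s t := (`|s| < e) /\ (`|t| < e).

(** Coordinates lie in [0, 1[, so the signs of s and t separate the cases, and the gluings are
    injective. Displacement by (s, t) is thus a partial function, without any smallness. *)
Lemma nbr_inj {O} (P : surface R O) s t Q Q' : nbr P s t Q -> nbr P s t Q' -> Q = Q'.
Proof.
have /and3P[/andP[qx0 qx1] /andP[qy0 qy1] _] := XYP Q.
have /and3P[/andP[qx0' qx1'] /andP[qy0' qy1'] _] := XYP Q'.
move=> [[hs hx hy]|[hs h0 hx hy]|[hs h0 hx hy]];
move=> [[hs' hx' hy']|[hs' h0' hx' hy']|[hs' h0' hx' hy']];
  try (exfalso; lra); apply: surfaceP; rewrite ?hx ?hy //.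
- by rewrite hs hs'.
- by apply: (@perm_inj _ (glue_right O)); rewrite hs hs'.
- by apply: (@perm_inj _ (glue_up O)); rewrite hs hs'.
Qed.

Lemma in_square_swap x y : in_square x y -> in_square y x.
Proof. by rewrite /in_square => /and3P[-> ->]; rewrite orbC. Qed.

Definition swap_map {O} (P : surface R O) : surface R (transpose O) :=
  @mkpt (transpose O) (square P) _ _ (in_square_swap (XYP P)).

Lemma swap_mapE {O} (P : surface R O) :
  [/\ square (swap_map P) = square P, X (swap_map P) = Y P & Y (swap_map P) = X P].
Proof. exact: mkptE. Qed.

Lemma nbr_swap {O} (P : surface R O) s t Q :
  nbr P s t Q <-> nbr (swap_map P) t s (swap_map Q).
Proof.
have [h1 h2 h3] := swap_mapE P; have [h4 h5 h6] := swap_mapE Q.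
rewrite /nbr h1 h2 h3 h4 h5 h6.
by split=> -[[]|[]|[]]; by [constructor 1|constructor 3|constructor 2].
Qed.

Lemma smallW e e' s t : e <= e' -> small e s t -> small e' s t.
Proof. by move=> ee [h1 h2]; split; apply: lt_le_trans ee. Qed.

Lemma small_bounds e s t : small e s t -> [/\ - e < s, s < e, - e < t & t < e].
Proof. by case; rewrite !ltr_norml => /andP[? ?] /andP[? ?]. Qed.

(** The vertex being removed, P lies on at most one of the left and lower edges; e is the distance
    to the edges that do not contain P. *)
Lemma nbr_ex {O} (P : surface R O) :
  exists2 e, 0 < e & forall s t, small e s t -> exists Q, nbr P s t Q.
Proof.
have := XYP P; rewrite /in_square.
set x := X P; set y := Y P => /and3P[/andP[x0 x1] /andP[y0 y1] nz].
have [xe|xn] := eqVneq x 0; have [ye|yn] := eqVneq y 0.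
- by rewrite xe ye !eqxx in nz.
- have yp : 0 < y by rewrite lt_def yn.
  exists (Num.min (Num.min y (1 - y)) 1); first by rewrite !lt_min; lra.
  move=> s t /small_bounds; set e := Num.min _ _ => -[h1 h2 h3 h4].
  have [he1 he2 he3] : [/\ e <= y, e <= 1 - y & e <= 1].
    by rewrite !ge_min !lexx ?orbT.
  have [sp|sn] := leP 0 s.
    have h : in_square s (y + t) by rewrite /in_square; lra.
    have [hs hx hy] := mkptE (square P) h.
    by exists (mkpt (square P) h); apply: Or31; rewrite hs hx hy -/x -/y; split => //; lra.
  have h : in_square (1 + s) (y + t) by rewrite /in_square; lra.
  pose j := ((glue_right O)^-1)%g (square P).
  have [hs hx hy] := mkptE j h.
  by exists (mkpt j h); apply: Or32; rewrite hs hx hy -/x -/y /j permKV; split.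
- have xp : 0 < x by rewrite lt_def xn.
  exists (Num.min (Num.min x (1 - x)) 1); first by rewrite !lt_min; lra.
  move=> s t /small_bounds; set e := Num.min _ _ => -[h1 h2 h3 h4].
  have [he1 he2 he3] : [/\ e <= x, e <= 1 - x & e <= 1].
    by rewrite !ge_min !lexx ?orbT.
  have [sp|sn] := leP 0 t.
    have h : in_square (x + s) t by rewrite /in_square; lra.
    have [hs hx hy] := mkptE (square P) h.
    by exists (mkpt (square P) h); apply: Or31; rewrite hs hx hy -/x -/y; split => //; lra.
  have h : in_square (x + s) (1 + t) by rewrite /in_square; lra.
  pose j := ((glue_up O)^-1)%g (square P).
  have [hs hx hy] := mkptE j h.
  by exists (mkpt j h); apply: Or33; rewrite hs hx hy -/x -/y /j permKV; split.
- have yp : 0 < y by rewrite lt_def yn.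
  have xp : 0 < x by rewrite lt_def xn.
  exists (Num.min (Num.min x (1 - x)) (Num.min y (1 - y))); first by rewrite !lt_min; lra.
  move=> s t /small_bounds; set e := Num.min _ _ => -[h1 h2 h3 h4].
  have [he1 he2 he3 he4] : [/\ e <= x, e <= 1 - x, e <= y & e <= 1 - y].
    by rewrite !ge_min !lexx ?orbT.
  have h : in_square (x + s) (y + t) by rewrite /in_square; lra.
  have [hs hx hy] := mkptE (square P) h.
  by exists (mkpt (square P) h); apply: Or31; rewrite hs hx hy.
Qed.

Lemma chart_cover {O} (P : surface R O) : exists c : chart O, chart_dom c P.
Proof.
have := XYP P; rewrite /in_square.
case/and3P=> [/andP[x0 x1] /andP[y0 y1] nz].
have [xe|xn] := eqVneq (X P) 0.
  rewrite xe eqxx /= in nz.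
  exists (RightEdge (((glue_right O)^-1)%g (square P))); split.
    by rewrite lt_def nz.
  by right; rewrite permKV; split=> //; rewrite -/(X P) xe; lra.
have [ye|yn] := eqVneq (Y P) 0.
  exists (UpperEdge (((glue_up O)^-1)%g (square P))); split.
    by rewrite lt_def xn.
  by right; rewrite permKV; split=> //; rewrite -/(Y P) ye; lra.
by exists (Inner (square P)); split; rewrite // lt_def ?xn ?yn.
Qed.


Lemma chart_mapE {O} (c : chart O) (P : surface R O) :
  xco (chart_map c P) = X P + (if c is RightEdge _ then (X P < 2^-1)%R%:R else 0) /\
  yco (chart_map c P) = Y P + (if c is UpperEdge _ then (Y P < 2^-1)%R%:R else 0).
Proof.
have [e1x e1y] := e1E; have [e2x e2y] := e2E.
case: c => i /=; rewrite ?addr0 //; case: ifP => _;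
  by rewrite ?xcoD ?ycoD ?e1x ?e1y ?e2x ?e2y ?addr0.
Qed.

(** An edge chart reads the coordinate across the edge as x + 1 if x < 1/2 and as x otherwise. The
    bounds on e keep the displacement from crossing 1/2, where this reading jumps, or the far
    edge. *)
Lemma edge_coordP (x x' s e : R) : 0 <= x < 1 -> 0 <= x' < 1 -> - e < s -> s < e ->
    e <= 2^-1 -> e <= 1 - x -> x = 0 \/ e <= x -> e <= x - 2^-1 \/ e <= 2^-1 - x ->
  x' + (x' < 2^-1)%R%:R = x + (x < 2^-1)%R%:R + s <->
  (x' = x + s /\ (x' < 2^-1) = (x < 2^-1)) \/ [/\ x = 0, x' = 1 + s & 2^-1 < x'].
Proof.
move=> hx hx' s1 s2 e1 e2 x0 xh.
case: (ltP x) => x1; case: (ltP x') => x1' /=.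
- split=> [h|[[h _]|[_ _ h]]]; [by left; split=> //; lra|lra|lra].
- split=> [h|[[_ //]|[-> -> _]]]; [right|ring].
  by case: x0 => x0; split; lra.
- by split=> [h|[[//]|[h _ _]]]; exfalso; lra.
- split=> [h|[[h _]|[h _ _]]]; [by left; split=> //; lra|lra|lra].
Qed.

Lemma half_coord (x s e : R) : - e < s -> s < e -> e <= x - 2^-1 \/ e <= 2^-1 - x ->
  (x + s < 2^-1) = (x < 2^-1) /\ (2^-1 < x + s) = (2^-1 < x).
Proof. by move=> s1 s2 [h|h]; split; apply/idP/idP; lra. Qed.

Let chart_nbr_right {O} (c : chart O) (P : surface R O) :
  (if c is UpperEdge _ then False else chart_dom c P) ->
  exists2 e, 0 < e & forall s t, small e s t -> forall Q,
    (chart_dom c Q /\ chart_map c Q = chart_map c P + col2 s t) <-> nbr P s t Q.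
Proof.
have /and3P[x01 y01 _] := XYP P.
(* The value 1 at u = 0 makes harmless the constraint from a line on which P already lies, so that e
   stays positive. *)
move=> cP; pose d (u : R) : R := if u == 0 then 1 else `|u|.
have d0 u : 0 < d u by rewrite /d; case: ifPn; rewrite ?ltr01 ?normr_gt0.
have dp u : 0 <= u -> u = 0 \/ d u <= u.
  by move=> u0; rewrite /d; case: eqVneq => [|_]; [left|right; rewrite ger0_norm].
pose e := Num.min (Num.min (d (X P)) (d (Y P)))
  (Num.min (d (X P - 2^-1)) (Num.min 2^-1 (1 - X P))).
exists e.
  by rewrite !lt_min !d0 /= invr_gt0 ltr0n subr_gt0; case/andP: x01.
move=> s t /small_bounds[s1 s2 t1 t2] Q.
have [e1 e2 e3 [e4 e5]] :
    [/\ e <= d (X P), e <= d (Y P), e <= d (X P - 2^-1) & e <= 2^-1 /\ e <= 1 - X P].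
  by rewrite !ge_min !lexx ?orbT.
have [[x0 x1] [y0 y1]] : (0 <= X P /\ X P < 1) /\ (0 <= Y P /\ Y P < 1).
  by move/andP: x01; move/andP: y01.
have eX : X P = 0 \/ e <= X P.
  by have [|/(le_trans e1)] := dp _ x0; [left|right].
have yt : 0 < Y P -> 0 < Y P + t.
  by have [->|/(le_trans e2)] := dp _ y0; [rewrite ltxx|lra].
have xs : 0 < X P -> 0 < X P + s by case: eX => [->|]; [rewrite ltxx|lra].
have /and3P[xQ01 /andP[_ yQ1] _] := XYP Q.
rewrite cV2_addP; have [-> ->] := chart_mapE c P; have [-> ->] := chart_mapE c Q.
case: c cP => i //=; rewrite -!/(X P) -!/(X Q) -!/(Y P) -!/(Y Q) ?addr0.
  move=> [hs hx hy]; split=> [[[hsq _ _] [hx' hy']]|]; first by apply: Or31; rewrite hs.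
  move=> [[hs' hx' hy']|[_ h0 _ _]|[_ h0 _ _]].
  - by rewrite hx' hy' hs' hs; split; split=> //; [apply: xs|apply: yt].
  - by rewrite h0 ltxx in hx.
  - by rewrite h0 ltxx in hy.
move=> [hy hP].
have eh : e <= X P - 2^-1 \/ e <= 2^-1 - X P.
  case: hP => -[_ hx]; [left|right]; move: e3; rewrite /d.
    by rewrite gt_eqF ?gtr0_norm ?subr_gt0.
  by rewrite lt_eqF ?ltr0_norm ?subr_lt0 // opprB.
have [half1 half2] := half_coord s1 s2 eh.
rewrite (edge_coordP x01 xQ01 s1 s2 e4 e5 eX eh).
split=> [[[_ hQ] [[[hx hh]|[hx0 hx hh]] hy']]|].
- apply: Or31; split=> //.
  case: hP hQ => -[-> hP] [[-> hQ]|[-> hQ]] //.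
    by move: hh; rewrite hQ (lt_gtF hP).
  by move: hh; rewrite hP (lt_gtF hQ).
- apply: Or32; split=> //; case: hP => -[-> hP].
    by move: hP; rewrite hx0 ltNge invr_ge0 ler0n.
  by case: hQ => -[-> //]; rewrite (lt_gtF hh).
move=> [[hs' hx' hy']|[hs' h0 hx' hy']|[_ h0 _ _]]; last by rewrite h0 ltxx in hy.
  rewrite hs' hx' hy' half1 half2; split; last by split=> //; left.
  by split; [apply: yt|].
have hQ : 2^-1 < X Q.
  rewrite hx'; lra.
split; last by split=> //; right.
rewrite hy'; split; first exact: yt.
left; split=> //; apply: (@perm_inj _ (glue_right O)); rewrite hs'.
by case: hP => -[-> //]; rewrite h0 ltNge invr_ge0 ler0n.
Qed.

(** Near P every chart reads displacements as [nbr] does, which allows [locally_affineE] to discard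
    the atlas. Upper edges follow from right edges by transposition. *)
Lemma chart_nbr {O} (c : chart O) (P : surface R O) : chart_dom c P ->
  exists2 e, 0 < e & forall s t, small e s t -> forall Q,
    (chart_dom c Q /\ chart_map c Q = chart_map c P + col2 s t) <-> nbr P s t Q.
Proof.
case: c => [i|i|i] cP; [exact: (@chart_nbr_right _ (Inner i))
                       |exact: (@chart_nbr_right _ (RightEdge i))|].
pose c := @RightEdge (transpose O) i.
have domE (Q : surface R O) : chart_dom (UpperEdge i) Q <-> chart_dom c (swap_map Q).
  by have [h1 h2 h3] := swap_mapE Q; rewrite /= -!/(X _) -!/(Y _) h1 h2 h3.
have mapE (Q : surface R O) : xco (chart_map (UpperEdge i) Q) = yco (chart_map c (swap_map Q)) /\
    yco (chart_map (UpperEdge i) Q) = xco (chart_map c (swap_map Q)).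
  have [-> ->] := chart_mapE (UpperEdge i) Q; have [-> ->] := chart_mapE c (swap_map Q).
  by have [h1 h2 h3] := swap_mapE Q; rewrite /= h2 h3.
have cP' : chart_dom c (swap_map P) by apply/domE.
have [e e0 he] := @chart_nbr_right (transpose O) c _ cP'.
exists e => // s t [hs ht] Q; rewrite nbr_swap -he // domE.
rewrite !cV2_addP; have [-> ->] := mapE Q; have [-> ->] := mapE P.
by split=> -[h1 [h2 h3]].
Qed.

End Surface.

Section Affine.
Context {R : realType}.
Implicit Types (O : origami) (x y s t e : R).

Definition lin0 (A : 'M[R]_2) s t := A 0 0 * s + A 0 1 * t.
Definition lin1 (A : 'M[R]_2) s t := A 1 0 * s + A 1 1 * t.

Lemma mulmx_col2 (A : 'M[R]_2) s t : A *m col2 s t = col2 (lin0 A s t) (lin1 A s t).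
Proof. by apply: cV2P; rewrite /xco /yco mulmx2E !mxE. Qed.

Definition local_affine {O O'} (A : 'M[R]_2) (f : surface R O -> surface R O') : Prop :=
  forall P, exists2 e, 0 < e & forall s t, small e s t ->
    forall Q, nbr P s t Q -> nbr (f P) (lin0 A s t) (lin1 A s t) (f Q).

Lemma lin_small (A : 'M[R]_2) e : 0 < e ->
  exists2 e', 0 < e' & forall s t, small e' s t -> small e (lin0 A s t) (lin1 A s t).
Proof.
move=> e0; pose M := 1 + \sum_i \sum_j `|A i j|.
have hM i j : `|A i j| <= \sum_i \sum_j `|A i j|.
  rewrite (bigD1 i) //= (bigD1 j) //= -addrA lerDl addr_ge0 ?sumr_ge0 // => *.
  by rewrite sumr_ge0.
have M0 : 0 < M by rewrite ltr_pwDl // sumr_ge0 // => i _; rewrite sumr_ge0.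
have lM i j : `|A i j| <= M by apply: le_trans (hM i j) _; rewrite lerDr.
have H i s t : small (e / (2 * M)) s t -> `|A i 0 * s + A i 1 * t| < e.
  move=> [hs ht]; apply: le_lt_trans (ler_normD _ _) _; rewrite !normrM.
  have aux (u : R) j : `|u| < e / (2 * M) -> `|A i j| * `|u| < e / 2.
    move=> hu; apply: (@le_lt_trans _ _ (M * `|u|)); first by rewrite ler_wpM2r.
    by rewrite mulrC -ltr_pdivlMr // -mulrA -invfM.
  by have := aux s 0 hs; have := aux t 1 ht; lra.
exists (e / (2 * M)); first by rewrite divr_gt0 ?mulr_gt0.
by move=> s t h; split; apply: H.
Qed.


Lemma nbhs_cV (w : 'cV[R]_2) (S : 'cV[R]_2 -> Prop) :
  (\forall z \near w, S z) <->
  exists2 e, 0 < e & forall s t, small e s t -> S (w + col2 s t).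
Proof.
split=> [/nbhs_ballP[e /= e0 he]|[e e0 he]].
  exists e => // s t [hs ht]; apply: he; split=> //; apply: forall_ord2 => j;
    rewrite ord1 /ball /= !mxE opprD addNKr normrN //.
apply/nbhs_ballP; exists e => // z [_ hz].
have -> : z = w + col2 (xco z - xco w) (yco z - yco w).
  by apply: cV2P; rewrite ?xcoD ?ycoD ?xco_col2 ?yco_col2; ring.
have := hz 0 0; have := hz 1 0; rewrite /ball /= => h1 h0.
by apply: he; split; rewrite distrC.
Qed.

Lemma locally_affineE {O} (A : 'M[R]_2) (f : surface R O -> surface R O) :
  locally_affine A f <-> local_affine A f.
Proof.
split=> [Hf P|Hf c c' P cP cfP].
  have [c cP] := chart_cover P; have [c' cfP] := chart_cover (f P).
  have [z0 /nbhs_cV[e1 e1_0 he1]] := Hf c c' P cP cfP.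
  have [e2 e2_0 he2] := chart_nbr cP.
  have [e3 e3_0 he3] := chart_nbr cfP.
  have [e4 e4_0 he4] := lin_small A e3_0.
  (* Evaluating at P itself determines the translation constant. *)
  have z0E : chart_map c' (f P) = A *m chart_map c P + z0.
    have c0 (z : 'cV[R]_2) : z + col2 0 0 = z.
      by apply: cV2P; rewrite ?xcoD ?ycoD ?xco_col2 ?yco_col2 addr0.
    have s0 : small e1 0 0 by split; rewrite normr0.
    by have [] := he1 0 0 s0 P cP (esym (c0 _)); rewrite c0.
  exists (Num.min e1 (Num.min e2 e4)); first by rewrite !lt_min e1_0 e2_0.
  move=> s t h Q PQ.
  have h1 : small e1 s t by apply: smallW h; rewrite ge_min lexx.
  have h2 : small e2 s t by apply: smallW h; rewrite !ge_min lexx orbT.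
  have h4 : small e4 s t by apply: smallW h; rewrite !ge_min lexx !orbT.
  have [cQ hQ] := (he2 s t h2 Q).2 PQ.
  have [cfQ hfQ] := he1 s t h1 Q cQ hQ.
  apply/(he3 _ _ (he4 _ _ h4)); split=> //.
  by rewrite hfQ z0E mulmxDr mulmx_col2 addrAC.
have [e1 e1_0 he1] := chart_nbr cP; have [e2 e2_0 he2] := chart_nbr cfP.
have [e3 e3_0 he3] := Hf P; have [e4 e4_0 he4] := lin_small A e2_0.
exists (chart_map c' (f P) - A *m chart_map c P); apply/nbhs_cV.
exists (Num.min e1 (Num.min e3 e4)); first by rewrite !lt_min e1_0 e3_0.
move=> s t h Q cQ hQ.
have h1 : small e1 s t by apply: smallW h; rewrite ge_min lexx.
have h3 : small e3 s t by apply: smallW h; rewrite !ge_min lexx orbT.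
have h4 : small e4 s t by apply: smallW h; rewrite !ge_min lexx !orbT.
have PQ : nbr P s t Q by apply/(he1 s t h1).
have [cfQ hfQ] := (he2 _ _ (he4 _ _ h4) _).2 (he3 s t h3 Q PQ).
by split=> //; rewrite hfQ -mulmx_col2 mulmxDr [RHS]addrC addrA subrK.
Qed.

Lemma local_affine_comp {O O' O''} (A B : 'M[R]_2)
    (f : surface R O' -> surface R O'') (g : surface R O -> surface R O') :
  local_affine A f -> local_affine B g -> local_affine (A *m B) (f \o g).
Proof.
move=> Hf Hg P; have [e1 e1_0 he1] := Hg P; have [e2 e2_0 he2] := Hf (g P).
have [e3 e3_0 he3] := lin_small B e2_0.
exists (Num.min e1 e3); first by rewrite lt_min e1_0.
move=> s t h Q PQ.
have h1 : small e1 s t by apply: smallW h; rewrite ge_min lexx.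
have h3 : small e3 s t by apply: smallW h; rewrite !ge_min lexx orbT.
have := he2 _ _ (he3 _ _ h3) _ (he1 _ _ h1 _ PQ).
rewrite /lin0 /lin1 !mulmx2E.
by congr nbr; ring.
Qed.

Lemma local_affine_id {O} : local_affine 1%:M (@id (surface R O)).
Proof.
move=> P; exists 1 => // s t _ Q; rewrite /lin0 /lin1 !mxE /=.
by rewrite !mul1r !mul0r addr0 add0r.
Qed.

(** Continuity of g is not assumed: the point at displacement A^-1 (s, t) from [g P'] exists for
    small (s, t), f carries it to displacement (s, t) from P', and displaced points are unique. *)
Lemma local_affine_inv {O O'} (A : 'M[R]_2)
    (f : surface R O -> surface R O') (g : surface R O' -> surface R O) :
  A \in unitmx -> cancel f g -> cancel g f ->
  local_affine A f -> local_affine (invmx A) g.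
Proof.
move=> Au fK gK Hf P'.
have [e1 e1_0 he1] := Hf (g P'); have [e2 e2_0 he2] := nbr_ex (g P').
have e12 : 0 < Num.min e1 e2 by rewrite lt_min e1_0.
have [e3 e3_0 he3] := lin_small (invmx A) e12.
exists e3 => // s t h Q' PQ'.
have h1 := smallW _ (he3 _ _ h); have h2 := smallW _ (he3 _ _ h).
have [|Q PQ] := he2 _ _ (h2 _ _); first by rewrite ge_min lexx orbT.
suff -> : Q' = f Q by rewrite fK.
apply: nbr_inj PQ' _; have := he1 _ _ (h1 _ _) _ PQ; rewrite gK.
rewrite ge_min lexx => /(_ isT).
have := congr1 (fun M => M *m col2 s t) (mulmxV Au).
rewrite mul1mx -mulmxA !mulmx_col2 => h4.
have := congr1 xco h4; have := congr1 yco h4; rewrite !xco_col2 !yco_col2.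
by move=> -> ->.
Qed.
End Affine.

(** * Shears *)

Definition mx2 {K : Type} (a b c d : K) : 'M[K]_2 :=
  \matrix_(i, j) if i == 0 then (if j == 0 then a else b)
                 else (if j == 0 then c else d).

Lemma mx2P (K : Type) (A B : 'M[K]_2) :
  A 0 0 = B 0 0 -> A 0 1 = B 0 1 -> A 1 0 = B 1 0 -> A 1 1 = B 1 1 -> A = B.
Proof. by move=> h1 h2 h3 h4; apply/matrixP; do 2!apply: forall_ord2. Qed.

Lemma mulmx_mx2 (K : pzRingType) (a b c d a' b' c' d' : K) :
  mx2 a b c d *m mx2 a' b' c' d' =
  mx2 (a * a' + b * c') (a * b' + b * d') (c * a' + d * c') (c * b' + d * d').
Proof. by apply: mx2P; rewrite mulmx2E !mxE. Qed.

Lemma det_mx2E (K : comNzRingType) (a b c d : K) : \det (mx2 a b c d) = a * d - b * c.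
Proof. by rewrite det_mx2 !mxE. Qed.

Lemma mx2_1 (K : pzRingType) : 1%:M = mx2 1 0 0 1 :> 'M[K]_2.
Proof. by apply: mx2P; rewrite !mxE. Qed.

Lemma inj_surj_bijective (T U : Type) (f : T -> U) :
  injective f -> (forall y, exists x, f x = y) -> bijective f.
Proof.
move=> fI fS; have [g fgK] := choice fS.
by exists g => // x; apply: fI; rewrite fgK.
Qed.

Section Equivalence.
Context {R : realType}.
Implicit Types (O : origami) (x y s t e : R).

(** Two origamis and no sign condition on det A, so that the reflection and the shears compose
    freely; [VeechE] restores the orientation. *)
Definition affine_equiv O O' (A : 'M[R]_2) : Prop :=
  exists2 f : surface R O -> surface R O', bijective f & local_affine A f.

Lemma VeechE O (A : 'M[R]_2) :
  Veech_group R O A <-> 0 < \det A /\ affine_equiv O O A.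
Proof.
split=> [[f [fb A0 /locally_affineE fA]]|[A0 [f fb fA]]].
  by split=> //; exists f.
by exists f; split=> //; apply/locally_affineE.
Qed.

Lemma affine_equiv_comp O O' O'' A B :
  affine_equiv O' O'' A -> affine_equiv O O' B -> affine_equiv O O'' (A *m B).
Proof.
move=> [f fb fA] [g gb gB]; exists (f \o g); first exact: bij_comp.
exact: local_affine_comp.
Qed.

Lemma affine_equiv1 O : affine_equiv O O 1%:M.
Proof. by exists id; [exists id|apply: local_affine_id]. Qed.

Lemma affine_equiv_inv O O' A :
  A \in unitmx -> affine_equiv O O' A -> affine_equiv O' O (invmx A).
Proof.
move=> Au [f [g fK gK] fA]; exists g; first by exists f.
exact: local_affine_inv fA.
Qed.

End Equivalence.

Lemma gen_shear (gT : finGroupType) (g h : gT) (k : nat) :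
  (<<[set g; g ^- k * h]>> = <<[set g; h]>>)%g.
Proof.
apply/eqP; rewrite finset.eqEsubset !gen_subG !finset.subUset !finset.sub1set.
have gI (a b : gT) : a \in <<[set a; b]>>%g by rewrite mem_gen ?finset.set21.
have hI (a b : gT) : b \in <<[set a; b]>>%g by rewrite mem_gen ?finset.set22.
apply/andP; split; apply/andP; split; rewrite ?gI //.
  by rewrite groupM ?groupV ?groupX ?gI ?hI.
by rewrite -[X in X \in _](mulKVg (g ^+ k)%g h) groupM ?groupX ?gI ?hI.
Qed.

Lemma shear_transitive (O : origami) (k : nat) :
  [transitive <<[set glue_right O; (glue_right O ^- k * glue_up O)%g]>>%g,
     on [set: 'I_(degree O)] | 'P].
Proof.
have E : <<[set glue_right O; (glue_right O ^- k * glue_up O)%g]>>%g =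
    <<[set glue_right O; glue_up O]>>%g by exact: gen_shear.
by rewrite E; apply: origami_transitive.
Qed.

(** The image of O under (1 k; 0 1), cut again into unit squares. Climbing through an old square
    drifts k squares to the right, so above j lies sigma_b of sigma_a^-k j. *)
Definition shear_origami (O : origami) (k : nat) : origami :=
  Origami (shear_transitive O k).

Section Shear.
Context {R : realType}.
Implicit Types (O : origami) (x y s t e : R).

Lemma affine_equiv_swap O : affine_equiv O (transpose O) (mx2 0 1 1 0 : 'M[R]_2).
Proof.
exists swap_map.
  apply: inj_surj_bijective => [P Q e|Q].
    have := swap_mapE P; rewrite e; have [-> -> ->] := swap_mapE Q.
    by move=> [h1 h2 h3]; apply: surfaceP.
  have h := in_square_swap (XYP Q); exists (@mkpt _ O (square Q) _ _ h).
  have [h1 h2 h3] := @mkptE _ O (square Q) _ _ h.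
  by have [h4 h5 h6] := swap_mapE (@mkpt _ O (square Q) _ _ h); apply: surfaceP; congruence.
move=> P; exists 1 => // s t _ Q /nbr_swap.
by rewrite /lin0 /lin1 !mxE /= !mul0r !mul1r add0r addr0.
Qed.

Section ShearMap.
Context {O : origami} (k : nat).
Implicit Types P Q : surface R O.

Definition shear_abs P : R := X P + k%:R * Y P.
Definition shear_num P : nat := Num.truncn (shear_abs P).

Lemma shear_abs_ge0 P : 0 <= shear_abs P.
Proof.
have /and3P[/andP[x0 _] /andP[y0 _] _] := XYP P.
by rewrite addr_ge0 ?mulr_ge0.
Qed.

Lemma shear_numP P :
  (shear_num P)%:R <= shear_abs P < (shear_num P)%:R + 1.
Proof. by rewrite natr1; apply: truncn_itv (shear_abs_ge0 P). Qed.

Lemma shear_numE P n : n%:R <= shear_abs P < n%:R + 1 -> shear_num P = n.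
Proof. by move=> h; apply: truncn_def; rewrite -natr1. Qed.

Lemma shear_in_square P : in_square (shear_abs P - (shear_num P)%:R) (Y P).
Proof.
have /and3P[/andP[x0 x1] /andP[y0 y1] nz] := XYP P.
have /andP[h1 h2] := shear_numP P.
rewrite /in_square y0 y1 !subr_ge0 h1 ltrBlDl h2 /=.
have [ye|//] := eqVneq (Y P) 0; last by rewrite orbT.
rewrite ye eqxx /= orbF in nz.
by rewrite (@shear_numE _ 0) /shear_abs ye mulr0 addr0 ?subr0 ?add0r ?nz ?x0.
Qed.

Definition shear_map P : surface R (shear_origami O k) :=
  @mkpt _ (shear_origami O k) ((glue_right O ^+ shear_num P)%g (square P)) _ _
    (shear_in_square P).

Lemma shear_mapE P :
  [/\ square (shear_map P) = (glue_right O ^+ shear_num P)%g (square P),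
      X (shear_map P) = shear_abs P - (shear_num P)%:R & Y (shear_map P) = Y P].
Proof. exact: mkptE. Qed.

Lemma shear_map_bij : bijective shear_map.
Proof.
apply: inj_surj_bijective => [P Q e|Q].
  have [h1 h2 h3] := shear_mapE P; have [h4 h5 h6] := shear_mapE Q.
  rewrite -e h1 in h4; rewrite -e h2 in h5; rewrite -e h3 in h6.
  have /and3P[/andP[x0 x1] _ _] := XYP P; have /and3P[/andP[x0' x1'] _ _] := XYP Q.
  rewrite /shear_abs h6 in h5.
  have en : shear_num P = shear_num Q.
    have := shear_numP P; have := shear_numP Q; rewrite /shear_abs h6.
    have leq_num (m n : nat) : m%:R < n%:R + 1 :> R -> (m <= n)%N.
      by rewrite natr1 ltr_nat.
    by move=> ? ?; apply/eqP; rewrite eqn_leq; apply/andP; split; apply: leq_num; lra.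
  apply: surfaceP => //; last by rewrite en in h5; lra.
  by rewrite en in h4; apply: (perm_inj h4).
have /and3P[/andP[x0 x1] /andP[y0 y1] nz] := XYP Q.
have ky : 0 <= k%:R * Y Q by rewrite mulr_ge0.
have := truncn_itv ky; set n0 := Num.truncn _; rewrite -natr1 => /andP[h1 h2].
(* x is the fractional part of [X Q - k%:R * Y Q], and n counts the squares passed by the sheared
   point; n is n0 or n0 + 1. *)
have [n [x [hx hn]]] : exists n x, 0 <= x < 1 /\ x + k%:R * Y Q = X Q + n%:R.
  have [h|h] := leP (k%:R * Y Q - n0%:R) (X Q).
    by exists n0, (X Q - (k%:R * Y Q - n0%:R)); split; lra.
  exists n0.+1, (X Q - (k%:R * Y Q - n0%:R) + 1); rewrite -natr1; split; lra.
have hs : in_square x (Y Q).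
  rewrite /in_square y0 y1 hx; have [ye|] := eqVneq (Y Q) 0; last by rewrite orbT.
  rewrite ye eqxx /= ?orbF ?andbT in nz hn *.
  rewrite mulr0 addr0 in hn; rewrite hn.
  (* On the lower edge the shear is the identity, so x is not the removed vertex. *)
  have n_0 : n = 0%N.
    by apply/eqP; rewrite -leqn0 -ltnS -(@ltr_nat R); lra.
  by rewrite n_0 addr0 nz.
pose j := ((glue_right O ^- n)%g (square Q : 'I_(degree O))).
exists (mkpt j hs); have [h3 h4 h5] := mkptE j hs.
have sa : shear_abs (mkpt j hs) = X Q + n%:R by rewrite /shear_abs h4 h5.
have nE : shear_num (mkpt j hs) = n by apply: shear_numE; rewrite sa; lra.
have [h6 h7 h8] := shear_mapE (mkpt j hs).
apply: surfaceP; first by rewrite h6 nE h3 /j permKV.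
  by rewrite h7 sa nE addrK.
by rewrite h8.
Qed.

Lemma shear_map_affine : local_affine (mx2 1 k%:R 0 1) shear_map.
Proof.
set A := mx2 _ _ _ _ => P.
have l1 s t : lin1 A s t = t by rewrite /lin1 !mxE /= mul0r mul1r add0r.
have l0 s t : lin0 A s t = s + k%:R * t by rewrite /lin0 !mxE /= mul1r.
have /and3P[/andP[x0 x1] /andP[y0 y1] nz] := XYP P.
have [sP XP YP] := shear_mapE P.
(* Below the lower edge the height is close to 1 and the sheared abscissa gains k; the factor
   sigma_a^-k in the new upper gluing absorbs this. *)
have [yP|yn] := eqVneq (Y P) 0.
  rewrite yP eqxx orbF in nz.
  have xp : 0 < X P by rewrite lt_def nz.
  have aP : shear_abs P = X P by rewrite /shear_abs yP mulr0 addr0.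
  have nP : shear_num P = 0%N by apply: shear_numE; rewrite aP x0 add0r.
  rewrite nP expg0 perm1 in sP; rewrite aP nP subr0 in XP.
  have e0 : 0 < Num.min (X P) (1 - X P) by rewrite lt_min xp subr_gt0.
  have [e' e'0 he'] := lin_small A e0.
  exists e' => // s t /he' /small_bounds; rewrite l0 l1; set e := Num.min _ _.
  move=> [h1 h2 _ _] Q.
  have [e1 e2] : e <= X P /\ e <= 1 - X P by rewrite !ge_min !lexx orbT.
  have /and3P[/andP[qx0 qx1] /andP[qy0 qy1] _] := XYP Q.
  have [sQ XQ YQ] := shear_mapE Q.
  move=> [[hs hx hy]|[hs h0 hx hy]|[hs h0 hx hy]].
  - have aQ : shear_abs Q = X P + (s + k%:R * t) by rewrite /shear_abs hx hy yP; ring.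
    have nQ : shear_num Q = 0%N by apply: shear_numE; rewrite aQ; lra.
    apply: Or31; rewrite sQ nQ expg0 perm1 sP XQ aQ nQ subr0 XP YQ YP.
    by split.
  - by rewrite h0 eqxx in nz.
  - have aQ : shear_abs Q = X P + (s + k%:R * t) + k%:R by rewrite /shear_abs hx hy; ring.
    have nQ : shear_num Q = k by apply: shear_numE; rewrite aQ; lra.
    apply: Or33; rewrite XQ aQ nQ addrK XP YQ YP; split=> //.
    by rewrite sQ nQ sP -hs /= permM permK.
have yp : 0 < Y P by rewrite lt_def yn.
have := shear_numP P; set w := shear_abs P; set n := shear_num P.
move=> /andP[n1 n2].
(* If w is an integer, the image is on a left edge, which a small step may cross; the bound 1 is
   then enough. *)
pose e := if w == n%:R then 1 else Num.min (w - n%:R) (n%:R + 1 - w).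
have e0 : 0 < e.
  by rewrite /e; case: eqVneq => // nw; rewrite lt_min !subr_gt0 n2 lt_def nw n1.
have [e' e'0 he'] := lin_small A e0.
exists e' => // s t /he' /small_bounds; rewrite l0 l1; set d := s + _.
move=> [h1 h2 _ _] Q PQ.
have [hle hge] : w + d < n%:R + 1 /\ (w + d < n%:R -> w = n%:R /\ n%:R - 1 < w + d).
  move: h1 h2; rewrite /e; case: eqVneq => [-> |_]; first by move=> *; split => [|_]; lra.
  set e1 := Num.min _ _; have : e1 <= w - n%:R /\ e1 <= n%:R + 1 - w.
    by rewrite !ge_min !lexx orbT.
  by move=> [? ?] ? ?; split=> [|?]; lra.
(* m is 1 if Q lies across the left edge from P, and 0 otherwise. *)
suff [m [hm ha hy]] : exists m : nat,
    [/\ (glue_right O ^+ (n + m))%g (square Q) = (glue_right O ^+ n)%g (square P),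
        shear_abs Q = w + d + m%:R & Y Q = Y P + t].
  have [sQ XQ YQ] := shear_mapE Q.
  have [hd|hd] := leP n%:R (w + d).
    have nQ : shear_num Q = (n + m)%N by apply: shear_numE; rewrite ha natrD; lra.
    apply: Or31; rewrite sQ nQ sP XQ XP YQ YP ha nQ natrD; split=> //.
    by rewrite -/w -/n; ring.
  have [wn hd'] := hge hd.
  have [n' nE] : exists n', (n + m)%N = n'.+1.
    case E : (n + m)%N => [|n']; last by exists n'.
    have := shear_abs_ge0 Q; have := congr1 (fun n => n%:R : R) E.
    by rewrite /= natrD ha; lra.
  have nE' : n%:R + m%:R = n'%:R + 1 :> R by rewrite -natrD nE natr1.
  have nQ : shear_num Q = n' by apply: shear_numE; rewrite ha; lra.
  apply: Or32; rewrite sQ nQ sP XQ XP YQ YP ha nQ; split=> //; rewrite -/w -/n; [|lra|lra].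
  by rewrite -hm nE expgSr permM.
move: PQ => [[hs hx hy]|[hs h0 hx hy]|[hs h0 hx hy]].
- exists 0%N; rewrite addn0 hs; split=> //.
  by rewrite /w /d /shear_abs hx hy; ring.
- exists 1%N; rewrite addn1 expgS permM hs; split=> //.
  by rewrite /w /d /shear_abs hx hy h0; ring.
- by rewrite h0 ltxx in yp.
Qed.

End ShearMap.

Lemma affine_equiv_shear O k : affine_equiv O (shear_origami O k) (mx2 1 k%:R 0 1 : 'M[R]_2).
Proof. by exists (@shear_map O k); [apply: shear_map_bij|apply: shear_map_affine]. Qed.

End Shear.

(** * Rigidity of affine maps *)

Section Rigidity.
Local Open Scope classical_set_scope.
Context {R : realType}.
Implicit Types (O : origami) (x y s t e : R).

(** Connectedness of the line: the indicator of F t <> F a is continuous, and the intermediate value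
    theorem would give it the value 1/2. *)
Lemma locally_const (T : Type) (F : R -> T) :
  (forall t, exists2 e, 0 < e & forall t', `|t' - t| < e -> F t' = F t) ->
  forall a b, F a = F b.
Proof.
move=> HF; have le a b : a <= b -> F a = F b.
  move=> ab; apply: contrapT => Fab.
  pose G t : R := if `[< F t = F a >] then 0 else 1.
  have Gc : {within `[a, b]%classic, continuous G}.
    apply: continuous_subspaceT => t; apply: cvg_near_cst.
    have [e e0 he] := HF t; apply/nbhs_ballP; exists e => // t' /=.
    by rewrite /ball /= distrC /G => /he ->.
  have Ga : G a = 0 by rewrite /G asboolT.
  have Gb : G b = 1 by rewrite /G asboolF // => /esym.
  have [|c _] := @IVT R G a b 2^-1 ab Gc.
    by rewrite Ga Gb min_l ?max_r //; lra.
  by rewrite /G; case: ifP => _; lra.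
move=> a b; have [/le //|/ltW/le] := leP a b; exact: esym.
Qed.

Lemma unit_locally_const (T : Type) (F : R -> T) :
  (forall x, 0 < x < 1 -> exists2 e, 0 < e &
     forall x', 0 < x' < 1 -> `|x' - x| < e -> F x' = F x) ->
  forall x x', 0 < x < 1 -> 0 < x' < 1 -> F x = F x'.
Proof.
move=> HF; have le a b : 0 < a < 1 -> 0 < b < 1 -> a <= b -> F a = F b.
  (* Clamping to [a, b] is 1-Lipschitz and reduces the unit interval to the whole line. *)
  move=> a01 b01 ab; pose phi t := Num.max a (Num.min t b).
  have phiE t : (t <= a /\ phi t = a) \/ (b <= t /\ phi t = b) \/
      (a <= t <= b /\ phi t = t).
    rewrite /phi; have [tb|bt] := leP t b; last by right; left; rewrite max_r //; lra.
    have [ta|at_] := leP t a; [by left | by right; right; split => //; lra].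
  have -> : a = phi a by have := phiE a; lra.
  have -> : b = phi b by have := phiE b; lra.
  apply: (locally_const (F := F \o phi)) => t /=.
  have p01 u : 0 < phi u < 1 by have := phiE u; lra.
  have [e e0 he] := HF _ (p01 t); exists e => // t' ht; apply: he => //.
  apply: le_lt_trans ht; rewrite ler_norml.
  have := phiE t; have := phiE t'.
  have [h|h] := ger0P (t' - t); lra.
move=> a b a01 b01; have [/le //|/ltW/le] := leP a b; [exact|move=> h].
exact/esym/h.
Qed.

Definition in_interior {O} (P : surface R O) : Prop := 0 < X P /\ 0 < Y P.

Lemma in_square_interior x y : 0 < x < 1 -> 0 < y < 1 -> in_square x y.
Proof. by move=> hx hy; rewrite /in_square; lra. Qed.

Lemma interior_const (T : Type) {O} (F : surface R O -> T) :
  (forall P, in_interior P -> exists2 e, 0 < e & forall s t, small e s t ->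
     forall Q, square Q = square P -> X Q = X P + s -> Y Q = Y P + t -> F Q = F P) ->
  forall P Q, square P = square Q -> in_interior P -> in_interior Q -> F P = F Q.
Proof.
move=> HF P Q PQ [Px Py] [Qx Qy].
have /and3P[/andP[_ px1] /andP[_ py1] _] := XYP P.
have /and3P[/andP[_ qx1] /andP[_ qy1] _] := XYP Q.
(* P is only the default value for (x, y) outside the half-open square. *)
pose i := square P; pose S x y : surface R O := insubd P (i, col2 x y).
have SE x y : 0 < x < 1 -> 0 < y < 1 -> [/\ square (S x y) = i, X (S x y) = x & Y (S x y) = y].
  move=> hx hy; have h := in_square_interior hx hy.
  by rewrite /S /square /X /Y /pos insubdK //= ?xco_col2 ?yco_col2 //;
    apply: in_square_half_open.
have hP : 0 < X P < 1 by rewrite Px.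
have hP' : 0 < Y P < 1 by rewrite Py.
have hQ : 0 < X Q < 1 by rewrite Qx.
have hQ' : 0 < Y Q < 1 by rewrite Qy.
have -> : P = S (X P) (Y P) by have [? ? ?] := SE _ _ hP hP'; apply: surfaceP.
have -> : Q = S (X Q) (Y Q) by have [? ? ?] := SE _ _ hQ hQ'; apply: surfaceP; rewrite -?PQ.
have HS x y : 0 < x < 1 -> 0 < y < 1 -> exists2 e, 0 < e & forall x' y',
    0 < x' < 1 -> 0 < y' < 1 -> `|x' - x| < e -> `|y' - y| < e -> F (S x' y') = F (S x y).
  move=> hx hy; have [h1 h2 h3] := SE _ _ hx hy.
  have [|e e0 he] := HF (S x y); first by rewrite /in_interior h2 h3; lra.
  exists e => // x' y' hx' hy' ex ey; have [h4 h5 h6] := SE _ _ hx' hy'.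
  by apply: (he (x' - x) (y' - y)); rewrite ?h1 ?h2 ?h3 ?h4 ?h5 ?h6 //; ring.
(* P is joined to Q by a horizontal and then a vertical segment in the open square. *)
transitivity (F (S (X Q) (Y P))).
  apply: (unit_locally_const (F := fun x => F (S x (Y P)))) => // x hx.
  have [e e0 he] := HS x _ hx hP'; exists e => // x' hx' ?.
  by apply: he => //; rewrite subrr normr0.
apply: (unit_locally_const (F := fun y => F (S (X Q) y))) => // y hy.
have [e e0 he] := HS _ y hQ hy; exists e => // y' hy' ?.
by apply: he => //; rewrite subrr normr0.
Qed.

Lemma int_eq0 (x : R) : x \is a Num.int -> -1 < x < 1 -> x = 0.
Proof.
move=> /intrP[m ->] /andP[h1 h2].
have {}h1 : -1 < m by rewrite -(ltr_int R).
have {}h2 : m < 1 by rewrite -(ltr_int R).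
by have -> : m = 0 by lia.
Qed.

Lemma int_translate (x y : R) : x - y \is a Num.int -> 0 <= x < 1 -> 0 <= y < 1 -> x = y.
Proof. by move=> /int_eq0 h ? ?; apply/eqP; rewrite -subr_eq0 h //; lra. Qed.

Lemma frac_ex (x : R) : exists2 y, 0 <= y < 1 & x - y \is a Num.int.
Proof.
exists (x - (Num.floor x)%:~R); last by rewrite opprB addrC subrK intr_int.
by have := floor_itv x; rewrite intrD; lra.
Qed.

(** The three cases of [nbr] coincide modulo Z^2: this is the projection to E. *)
Lemma nbr_int {O} (P : surface R O) s t Q : nbr P s t Q ->
  X Q - X P - s \is a Num.int /\ Y Q - Y P - t \is a Num.int.
Proof.
have E0 (a : R) : a = 0 -> a \is a Num.int by move=> ->; apply: rpred0.
have E1 (a : R) : a = 1 -> a \is a Num.int by move=> ->; apply: rpred1.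
by move=> [[_ -> ->]|[_ -> -> ->]|[_ -> -> ->]]; split;
  first [apply: E0; ring | apply: E1; ring].
Qed.

(** Even covering: whatever lies over a small neighbourhood of a point of E other than the puncture
    belongs to a sheet around one of its preimages. *)
Lemma nbr_of_int w1 w2 (h : in_square w1 w2) : exists2 e, 0 < e &
  forall O (Q : surface R O) s t, small e s t ->
    X Q - w1 - s \is a Num.int -> Y Q - w2 - t \is a Num.int ->
    exists j, nbr (mkpt j h) s t Q.
Proof.
have /and3P[/andP[x0 x1] /andP[y0 y1] nz] := h.
pose d (u : R) := if u == 0 then 1 else Num.min u (1 - u).
have d0 u : 0 <= u < 1 -> 0 < d u.
  by rewrite /d; case: eqVneq => // u0 hu; rewrite lt_min; lra.
exists (Num.min (d w1) (d w2)); first by rewrite lt_min !d0; lra.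
move=> O Q s t; set e := Num.min _ _ => /small_bounds[h1 h2 h3 h4].
have [e1 e2] : e <= d w1 /\ e <= d w2 by rewrite !ge_min !lexx orbT.
have /and3P[/andP[qx0 qx1] /andP[qy0 qy1] _] := XYP Q.
have key (w z r : R) : 0 <= w < 1 -> 0 <= z < 1 -> - e < r < e -> e <= d w ->
    z - w - r \is a Num.int -> z = w + r \/ (w = 0 /\ z = 1 + r).
  move=> hw hz hr; rewrite /d; case: eqVneq => [->|w0] ew hint.
    have [rn|rp] := ltP r 0; [right; split=> //|left].
      by apply: int_translate; [|lra|lra];
        rewrite (_ : _ - _ = z - 0 - r - 1); [exact: rpredB hint (rpred1 _)|ring].
    by apply: int_translate; [rewrite (_ : z - (0 + r) = z - 0 - r) //; ring|lra|lra].
  have [e3 e4] : e <= w /\ e <= 1 - w.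
    by split; apply: le_trans ew _; rewrite ge_min lexx ?orbT.
  by left; apply: int_translate; [rewrite (_ : z - (w + r) = z - w - r) //; ring|lra|lra].
move=> hX hY.
have nb j := mkptE j h.
have [hx|[wx hx]] : X Q = w1 + s \/ (w1 = 0 /\ X Q = 1 + s) by apply: key => //; lra.
  have [hy|[wy hy]] : Y Q = w2 + t \/ (w2 = 0 /\ Y Q = 1 + t) by apply: key => //; lra.
    exists (square Q); have [n1 n2 n3] := nb O (square Q).
    by apply: Or31; rewrite n1 n2 n3.
  exists (glue_up O (square Q)); have [n1 n2 n3] := nb O (glue_up O (square Q)).
  by apply: Or33; rewrite n1 n2 n3.
have [hy|[wy hy]] : Y Q = w2 + t \/ (w2 = 0 /\ Y Q = 1 + t) by apply: key => //; lra.
  exists (glue_right O (square Q)); have [n1 n2 n3] := nb O (glue_right O (square Q)).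
  by apply: Or32; rewrite n1 n2 n3.
by rewrite wx wy eqxx in nz.
Qed.

Definition near_lattice {O} e (P : surface R O) : Prop :=
  exists s t, [/\ small e s t, X P - s \is a Num.int & Y P - t \is a Num.int].

(** e is half the distance of a nonzero coordinate of P to the integers: the displacement and the
    distance to the lattice each use up less than e. *)
Lemma far_from_lattice {O} (P : surface R O) : exists2 e, 0 < e &
  forall s t, small e s t -> forall Q, nbr P s t Q -> ~ near_lattice e Q.
Proof.
have key (u z r r' e : R) : 0 <= u < 1 -> u != 0 -> - e < r < e -> - e < r' < e ->
    e <= u / 2 -> e <= (1 - u) / 2 ->
    z - u - r \is a Num.int -> z - r' \is a Num.int -> False.
  move=> hu /eqP u0 hr hr' e1 e2 i1 i2.
  have : u + r - r' \is a Num.int.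
    by rewrite (_ : _ - _ = (z - r') - (z - u - r)); [exact: rpredB|ring].
  have [un|un] : u < 1 / 2 \/ 1 / 2 <= u by lra.
    by move=> /int_eq0; lra.
  by move=> h; have : u + r - r' = 0; [apply: int_eq0 => //; lra|lra].
have /and3P[/andP[x0 x1] /andP[y0 y1] /orP[nz|nz]] := XYP P.
  exists (Num.min (X P / 2) ((1 - X P) / 2)).
    by rewrite lt_min; move/eqP: nz; lra.
  move=> s t /small_bounds; set e := Num.min _ _ => -[h1 h2 _ _] Q /nbr_int[hX _].
  move=> [s' [t' [/small_bounds[h3 h4 _ _] hX' _]]].
  have [e1 e2] : e <= X P / 2 /\ e <= (1 - X P) / 2 by rewrite !ge_min !lexx orbT.
  by apply: (key (X P) (X Q) s s' e) => //; lra.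
exists (Num.min (Y P / 2) ((1 - Y P) / 2)).
  by rewrite lt_min; move/eqP: nz; lra.
move=> s t /small_bounds; set e := Num.min _ _ => -[_ _ h1 h2] Q /nbr_int[_ hX].
move=> [s' [t' [/small_bounds[_ _ h3 h4] _ hX']]].
have [e1 e2] : e <= Y P / 2 /\ e <= (1 - Y P) / 2 by rewrite !ge_min !lexx orbT.
by apply: (key (Y P) (Y Q) t t' e) => //; lra.
Qed.

Lemma near_latticeW {O} e e' (P : surface R O) :
  e <= e' -> near_lattice e P -> near_lattice e' P.
Proof. by move=> ee [s [t [h1 h2 h3]]]; exists s, t; split=> //; apply: smallW h1. Qed.

Lemma finite_pos_bound (I : finType) (P : I -> R -> Prop) :
  (forall i, exists2 e, 0 < e & P i e) -> (forall i e e', e' <= e -> P i e -> P i e') ->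
  exists2 e, 0 < e & forall i, P i e.
Proof.
move=> HP Pm; have /choice[e he] : forall i, exists e, 0 < e /\ P i e.
  by move=> i; have [e] := HP i; exists e.
exists (\big[Num.min/1]_i e i).
  by elim/big_ind: _ => // [x y hx hy|i _]; [rewrite lt_min hx|have [] := he i].
move=> i; apply: Pm (proj2 (he i)).
by rewrite (bigD1 i) //= ge_min lexx.
Qed.

(* A neighbourhood of a nonsingular value w has finitely many sheets, each mapped
   by g away from the punctures. *)
Lemma proper_affine {O O'} (B : 'M[R]_2) (g : surface R O' -> surface R O) w1 w2 :
  local_affine B g -> in_square w1 w2 -> exists2 e, 0 < e &
    forall (Q : surface R O') s t, small e s t ->
      X Q - w1 - s \is a Num.int -> Y Q - w2 - t \is a Num.int ->
      ~ near_lattice e (g Q).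
Proof.
move=> gB h; have [e0 e0_0 he0] := nbr_of_int h.
have [e e1_0 he1] : exists2 e, 0 < e & forall j : 'I_(degree O'),
    forall s t, small e s t -> forall Q, nbr (mkpt j h) s t Q -> ~ near_lattice e (g Q).
  apply: (@finite_pos_bound _ (fun j e => forall s t, small e s t -> forall Q,
      nbr (mkpt j h) s t Q -> ~ near_lattice e (g Q))) => [j|j e e' ee he s t hs Q hQ].
    have [e2 e2_0 he2] := gB (mkpt j h); have [e3 e3_0 he3] := far_from_lattice (g (mkpt j h)).
    have [e4 e4_0 he4] := lin_small B e3_0.
    exists (Num.min e2 (Num.min e3 e4)); first by rewrite !lt_min e2_0 e3_0.
    move=> s t hs Q hQ.
    have h2 : small e2 s t by apply: smallW hs; rewrite ge_min lexx.
    have h4 : small e4 s t by apply: smallW hs; rewrite !ge_min lexx !orbT.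
    move=> hN; apply: (he3 _ _ (he4 _ _ h4) _ (he2 _ _ h2 _ hQ)).
    by apply: near_latticeW hN; rewrite !ge_min lexx orbT.
  by move=> hN; apply: (he s t (smallW ee hs) Q hQ); apply: near_latticeW hN.
exists (Num.min e0 e); first by rewrite lt_min e0_0.
move=> Q s t hs hX hY.
have [le0 le] : Num.min e0 e <= e0 /\ Num.min e0 e <= e by rewrite !ge_min !lexx orbT.
have [j hj] := he0 _ _ _ _ (smallW le0 hs) hX hY.
by move=> hN; apply: (he1 j _ _ (smallW le hs) _ hj); apply: near_latticeW hN.
Qed.

End Rigidity.

Section AffineRigidity.
Local Open Scope classical_set_scope.
Context {R : realType}.
Implicit Types (O : origami) (x y s t e : R).

Lemma unit_square_point {O} (i : 'I_(degree O)) x y : 0 < x < 1 -> 0 < y < 1 ->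
  exists P : surface R O, [/\ square P = i, X P = x & Y P = y].
Proof. by move=> hx hy; exists (mkpt i (in_square_interior hx hy)); exact: mkptE. Qed.

Section Affine.
Context {O O' : origami} (A : 'M[R]_2) (f : surface R O -> surface R O').
Hypotheses (fb : bijective f) (Au : A \in unitmx) (fA : local_affine A f).

Implicit Types (P Q : surface R O).

(** Meaningful modulo Z only, since [X (f P)] jumps by an integer when f P crosses an edge. *)
Definition defect0 P : R := X (f P) - lin0 A (X P) (Y P).
Definition defect1 P : R := Y (f P) - lin1 A (X P) (Y P).

Lemma defect_const P Q : square P = square Q -> in_interior P -> in_interior Q ->
  defect0 Q - defect0 P \is a Num.int /\ defect1 Q - defect1 P \is a Num.int.
Proof.
have E (a b c : R) : (b - a \is a Num.int) -> (c - a \is a Num.int) = (c - b \is a Num.int).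
  by move=> h; rewrite (_ : c - a = (b - a) + (c - b)); [exact: rpredDl|ring].
(* Passing to classes modulo Z^2 turns local constancy modulo Z^2 into plain local constancy. *)
pose F P := [set Q | defect0 Q - defect0 P \is a Num.int /\ defect1 Q - defect1 P \is a Num.int].
move=> PQ Pi Qi; suff FPQ : F P = F Q.
  by have : F Q Q; [rewrite /F /= !subrr !rpred0|rewrite -FPQ].
apply: (interior_const (F := F)) => // {PQ Pi Qi}P0 Pi.
have [e e0 he] := fA P0; exists e => // s t hs P1 h1 h2 h3.
have /nbr_int[i0 i1] : nbr (f P0) (lin0 A s t) (lin1 A s t) (f P1).
  by apply: he => //; apply: Or31.
have j0 : defect0 P1 - defect0 P0 \is a Num.int.
  suff -> : defect0 P1 - defect0 P0 = X (f P1) - X (f P0) - lin0 A s t by [].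
  by rewrite /defect0 /lin0 h2 h3; ring.
have j1 : defect1 P1 - defect1 P0 \is a Num.int.
  suff -> : defect1 P1 - defect1 P0 = Y (f P1) - Y (f P0) - lin1 A s t by [].
  by rewrite /defect1 /lin1 h2 h3; ring.
by apply/funext => S; rewrite /F /mkset (E _ _ _ j0) (E _ _ _ j1).
Qed.

(* As P tends to a vertex of its square, f P leaves every compact subset, so the
   value that the affine map takes at the vertex is a lattice point. *)
Lemma corner_int (i : 'I_(degree O)) (P0 : surface R O) (b0 b1 : bool) :
  in_interior P0 -> square P0 = i ->
  defect0 P0 + lin0 A b0%:R b1%:R \is a Num.int /\
  defect1 P0 + lin1 A b0%:R b1%:R \is a Num.int.
Proof.
move=> P0i P0s; have [g fK gK] := fb.
have gB := local_affine_inv Au fK gK fA.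
(* (v0, v1) represents modulo Z^2 the value at the vertex (b0, b1) of the affine extension of f. *)
have [v0 v0_01 hv0] := frac_ex (defect0 P0 + lin0 A b0%:R b1%:R).
have [v1 v1_01 hv1] := frac_ex (defect1 P0 + lin1 A b0%:R b1%:R).
have [vs|/norP[/negbNE/eqP e0 /negbNE/eqP e1]] := boolP ((v0 != 0) || (v1 != 0)); last first.
  by rewrite e0 subr0 in hv0; rewrite e1 subr0 in hv1.
exfalso; have {}vs : in_square v0 v1 by rewrite /in_square v0_01 v1_01.
have [e e_0 he] := proper_affine gB vs.
have [e' e'_0 he'] := lin_small A e_0.
pose eta := Num.min (1 / 2) (Num.min (e / 2) (e' / 2)).
have eta0 : 0 < eta by rewrite !lt_min; lra.
have [eta1 eta2 eta3] : [/\ eta <= 1 / 2, eta <= e / 2 & eta <= e' / 2]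
  by rewrite !ge_min !lexx ?orbT.
(* (s0, s1) points from the vertex (b0, b1) into the square. *)
pose s0 := if b0 then - eta else eta; pose s1 := if b1 then - eta else eta.
have ns0 : `|s0| = eta by rewrite /s0; case: (b0); rewrite ?normrN gtr0_norm.
have ns1 : `|s1| = eta by rewrite /s1; case: (b1); rewrite ?normrN gtr0_norm.
have c0 : 0 < b0%:R + s0 < 1 by rewrite /s0; case: (b0) => /=; lra.
have c1 : 0 < b1%:R + s1 < 1 by rewrite /s1; case: (b1) => /=; lra.
have [P [Ps PX PY]] := unit_square_point i c0 c1.
have Pi : in_interior P by rewrite /in_interior PX PY; lra.
have [] := defect_const (etrans P0s (esym Ps)) P0i Pi.
rewrite {1}/defect0 {1}/defect1 PX PY => d0 d1.
have hs : small e' s0 s1 by split; rewrite ?ns0 ?ns1; lra.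
apply: (he (f P) _ _ (he' s0 s1 hs)).
- by rewrite (_ : _ - _ = (X (f P) - lin0 A (b0%:R + s0) (b1%:R + s1) - defect0 P0) +
    (defect0 P0 + lin0 A b0%:R b1%:R - v0)); [exact: rpredD|rewrite /lin0; ring].
- by rewrite (_ : _ - _ = (Y (f P) - lin1 A (b0%:R + s0) (b1%:R + s1) - defect1 P0) +
    (defect1 P0 + lin1 A b0%:R b1%:R - v1)); [exact: rpredD|rewrite /lin1; ring].
rewrite fK; exists s0, s1; split; first by split; rewrite ?ns0 ?ns1; lra.
  by rewrite PX addrK; apply: rpred_nat.
by rewrite PY addrK; apply: rpred_nat.
Qed.

(** The vertex (0, 0) gives the defects; subtracting them at (1, 0) and (0, 1) gives the columns of
    A. *)
Lemma affine_integral (P : surface R O) : in_interior P ->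
  [/\ forall i j, A i j \is a Num.int, defect0 P \is a Num.int & defect1 P \is a Num.int].
Proof.
move=> Pi.
have [h0 h1] := corner_int false false Pi erefl.
have [h2 h3] := corner_int true false Pi erefl.
have [h4 h5] := corner_int false true Pi erefl.
move: h0 h1 h2 h3 h4 h5; rewrite /lin0 /lin1 !mulr0 !mulr1 !addr0 !add0r => h0 h1.
have sub (a b : R) : a \is a Num.int -> a + b \is a Num.int -> b \is a Num.int.
  by move=> ha hab; rewrite (_ : b = a + b - a); [exact: rpredB|ring].
move=> /(sub _ _ h0) h2 /(sub _ _ h1) h3 /(sub _ _ h0) h4 /(sub _ _ h1) h5.
by split=> //; do 2!apply: forall_ord2.
Qed.

End Affine.

Lemma exists_interior O (i : 'I_(degree O)) :
  exists P : surface R O, square P = i /\ in_interior P.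
Proof.
have h : 0 < (2^-1 : R) < 1 by lra.
have [P [Ps PX PY]] := unit_square_point i h h; exists P.
by rewrite /in_interior PX PY; split=> //; lra.
Qed.

(** The inverse map makes A^-1 integral too, so det A is a positive unit of Z. *)
Lemma affine_equiv_SL2Z O O' (A : 'M[R]_2) : (0 < degree O)%N ->
  0 < \det A -> affine_equiv O O' A -> SL2Z A.
Proof.
move=> d0 detA OO'.
have Au : A \in unitmx by rewrite unitmxE unitfE gt_eqF.
have d0' : (0 < degree O')%N.
  have [f _ _] := OO'; have [P _] := exists_interior (Ordinal d0).
  by case: (square (f P)) => m; apply: leq_trans.
have entries O1 O2 (B : 'M[R]_2) : (0 < degree O1)%N -> B \in unitmx -> affine_equiv O1 O2 B ->
    exists C : 'M[int]_2, B = map_mx intr C.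
  move=> d1 Bu [f fb fB]; have [P [_ Pi]] := exists_interior (Ordinal d1).
  have [BI _ _] := affine_integral fb Bu fB Pi.
  exists (map_mx (Num.floor : R -> int) B); apply/matrixP => i j; rewrite !mxE.
  by rewrite floorK.
have [B AB] := entries _ _ _ d0 Au OO'.
have Vu : invmx A \in unitmx by rewrite unitmx_inv.
have [C AC] := entries _ _ _ d0' Vu (affine_equiv_inv Au OO').
exists B; last by rewrite AB.
have BC : B *m C = 1%:M.
  have := mulmxV Au; rewrite AC {1}AB -map_mxM -(map_mx1 (intr : {rmorphism int -> R})).
  by move=> /matrixP E; apply/matrixP => i j; have := E i j; rewrite !mxE => /intr_inj.
have /(congr1 determinant) := BC; rewrite det_mulmx det1 => detBC.
have detB : 0 < \det B by rewrite -(ltr_int R) -det_map_mx -AB.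
move: detBC detB; rewrite /=; move: (\det B) (\det C) => b c bc b0.
have c0 : 0 < c by nia.
by nia.
Qed.

Lemma degree_gt0 O : (0 < degree O)%N.
Proof.
have /imsetP[x _ _] := origami_transitive O.
by case: x => m; apply: leq_trans.
Qed.

Lemma Veech_SL2Z O : Veech_group R O `<=` SL2Z.
Proof. by move=> A /VeechE[detA]; apply: affine_equiv_SL2Z => //; apply: degree_gt0. Qed.

Lemma SL2Z_unit (A : 'M[R]_2) : SL2Z A -> A \in unitmx /\ \det A = 1.
Proof. by move=> [B /= B1 <-]; rewrite unitmxE det_map_mx B1 unitr1. Qed.

Lemma Veech_subgroup O : subgroup_SL2Z (Veech_group R O).
Proof.
split; first exact: Veech_SL2Z.
- by apply/VeechE; rewrite det1; split; [|apply: affine_equiv1].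
- move=> A B /VeechE[A0 hA] /VeechE[B0 hB]; apply/VeechE.
  by rewrite det_mulmx mulr_gt0 //; split=> //; apply: affine_equiv_comp hB.
move=> A VA; have [Au A1] := SL2Z_unit (Veech_SL2Z VA).
apply/VeechE; rewrite det_inv A1 invr1; split=> //.
by apply: affine_equiv_inv => //; have [] := (VeechE O A).1 VA.
Qed.

(** Inside a square h moves coordinates by integers, hence not at all, as they stay in [0, 1[. Edge
    points are pushed inside, and the gluings are read off by comparing the midpoint of an edge with
    a point just across it. *)
Lemma translation_perm O O' (h : surface R O -> surface R O') :
  bijective h -> local_affine 1%:M h ->
  exists p : 'I_(degree O) -> 'I_(degree O'),
    [/\ forall P, [/\ square (h P) = p (square P), X (h P) = X P & Y (h P) = Y P],
        forall i, p (glue_right O i) = glue_right O' (p i)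
      & forall i, p (glue_up O i) = glue_up O' (p i)].
Proof.
move=> hb h1.
have l0 s t : lin0 (1%:M : 'M[R]_2) s t = s by rewrite /lin0 !mxE mul1r mul0r addr0.
have l1 s t : lin1 (1%:M : 'M[R]_2) s t = t by rewrite /lin1 !mxE mul1r mul0r add0r.
have XY01 O1 (P : surface R O1) : 0 <= X P < 1 /\ 0 <= Y P < 1.
  by have /and3P[] := XYP P.
have hi P : in_interior P -> X (h P) = X P /\ Y (h P) = Y P.
  move=> Pi; have [_] := affine_integral hb (unitmx1 _ _) h1 Pi.
  rewrite /defect0 /defect1 l0 l1 => d0 d1.
  by split; apply: int_translate => //; apply XY01.
have sc P Q : square P = square Q -> in_interior P -> in_interior Q ->
    square (h P) = square (h Q).
  apply: (interior_const (F := fun P => square (h P))) => {Q}{}P Pi.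
  have [e e0 he] := h1 P; exists e => // s t hs Q sQ XQ YQ.
  have [hX hY] := hi P Pi; have [Px Py] := Pi.
  have := he s t hs Q (Or31 _ _ (And3 sQ XQ YQ)).
  by move=> [[->] //|[_ h0]|[_ h0]]; rewrite ?hX ?hY in h0; exfalso; lra.
have /choice[c hc] := @exists_interior O.
pose p i := square (h (c i)).
have pi P : in_interior P -> square (h P) = p (square P).
  by move=> Pi; have [cs ci] := hc (square P); apply: sc.
have ptE P : [/\ square (h P) = p (square P), X (h P) = X P & Y (h P) = Y P].
  have /and3P[/andP[x0 x1] /andP[y0 y1] nz] := XYP P.
  have [e e0 he] := h1 P.
  pose s := Num.min (e / 2) (1 / 2).
  have s0 : 0 < s by rewrite lt_min; lra.
  have [s1 s2] : s <= e / 2 /\ s <= 1 / 2 by rewrite !ge_min !lexx orbT.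
  have ns : `|s| < e by rewrite gtr0_norm //; lra.
  have n0 : `|0 : R| < e by rewrite normr0.
  have s01 : 0 < s < 1 by lra.
  have [xe|/eqP xn] := eqVneq (X P) 0.
    have yp : 0 < Y P < 1 by move: nz; rewrite xe eqxx /= => /eqP; lra.
    have [Q [sQ XQ YQ]] := unit_square_point (square P) s01 yp.
    have Qi : in_interior Q by rewrite /in_interior XQ YQ; lra.
    have [hXQ hYQ] := hi Q Qi; have hsQ := pi Q Qi.
    have /he : nbr P s 0 Q by apply: Or31; rewrite XQ YQ xe add0r addr0.
    rewrite l0 l1 => /(_ (conj ns n0)); rewrite /nbr hXQ hYQ hsQ XQ YQ sQ.
    by move=> [[-> ? ?]|[_ ? ? _]|[_ ? _ ?]]; [split=> //; lra|exfalso; lra|exfalso; lra].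
  have [ye|/eqP yn] := eqVneq (Y P) 0.
    have xp : 0 < X P < 1 by lra.
    have [Q [sQ XQ YQ]] := unit_square_point (square P) xp s01.
    have Qi : in_interior Q by rewrite /in_interior XQ YQ; lra.
    have [hXQ hYQ] := hi Q Qi; have hsQ := pi Q Qi.
    have /he : nbr P 0 s Q by apply: Or31; rewrite XQ YQ ye add0r addr0.
    rewrite l0 l1 => /(_ (conj n0 ns)); rewrite /nbr hXQ hYQ hsQ XQ YQ sQ.
    by move=> [[-> ? ?]|[_ ? ? _]|[_ ? _ ?]]; [split=> //; lra|exfalso; lra|exfalso; lra].
  have Pi : in_interior P by split; lra.
  by have [? ?] := hi P Pi; split=> //; apply: pi.
pose half : R := 1 / 2.
have cross e : 0 < e -> exists s : R, [/\ 0 < s < 1, `|- s| < e & `|0 : R| < e].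
  move=> e0; exists (Num.min (e / 2) (1 / 2)); rewrite normr0 normrN.
  have s0 : 0 < Num.min (e / 2) (1 / 2) by rewrite lt_min; lra.
  have : Num.min (e / 2) (1 / 2) <= e / 2 /\ Num.min (e / 2) (1 / 2) <= 1 / 2.
    by rewrite !ge_min !lexx orbT.
  by rewrite (gtr0_norm s0); split=> //; lra.
have hh : 0 < half < 1 by rewrite /half; lra.
have h0 : in_square 0 half by rewrite /in_square /half; lra.
exists p; split=> // i.
  have [Ps PX PY] := mkptE (glue_right O i) h0; move: (mkpt _ _) Ps PX PY => P Ps PX PY.
  have [e e0 he] := h1 P; have [s [s01 ns n0]] := cross e e0.
  have hs : 0 < 1 - s < 1 by lra.
  have [Q [sQ XQ YQ]] := unit_square_point i hs hh.
  have /he : nbr P (- s) 0 Q by apply: Or32; rewrite sQ XQ YQ PX PY addr0.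
  rewrite l0 l1 => /(_ (conj ns n0)); rewrite /nbr.
  have [-> -> ->] := ptE Q; have [-> -> ->] := ptE P.
  by rewrite sQ XQ YQ Ps PX PY => -[[_ ? ?]|[-> _ _ _]|[_ ? _ ?]] //; exfalso; lra.
have [Ps PX PY] := mkptE (glue_up O i) (in_square_swap h0).
move: (mkpt _ _) Ps PX PY => P Ps PX PY.
have [e e0 he] := h1 P; have [s [s01 ns n0]] := cross e e0.
have hs : 0 < 1 - s < 1 by lra.
have [Q [sQ XQ YQ]] := unit_square_point i hh hs.
have /he : nbr P 0 (- s) Q by apply: Or33; rewrite sQ XQ YQ PX PY addr0.
rewrite l0 l1 => /(_ (conj n0 ns)); rewrite /nbr.
have [-> -> ->] := ptE Q; have [-> -> ->] := ptE P.
by rewrite sQ XQ YQ Ps PX PY => -[[_ ? ?]|[_ ? ? _]|[-> _ _ _]] //; exfalso; lra.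
Qed.

End AffineRigidity.

(** * Parabolic matrices and congruence subgroups *)

Lemma origami_eq (d : nat) (a b b' : 'S_d)
    (t : [transitive <<[set a; b]>>%g, on [set: 'I_d] | 'P])
    (t' : [transitive <<[set a; b']>>%g, on [set: 'I_d] | 'P]) :
  b = b' -> Origami t = Origami t'.
Proof. by move=> e; subst b'; rewrite (bool_irrelevance t t'). Qed.

Lemma unshear_transitive (O : origami) :
  [transitive <<[set glue_right O; (glue_right O * glue_up O)%g]>>%g,
     on [set: 'I_(degree O)] | 'P].
Proof.
have E : <<[set glue_right O; (glue_right O * glue_up O)%g]>>%g =
    <<[set glue_right O; glue_up O]>>%g.
  have := gen_shear (glue_right O) (glue_right O * glue_up O)%g 1.
  by rewrite expg1 mulKg => h; exact: esym h.
by rewrite E; apply: origami_transitive.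
Qed.

(** Plays the role of a shear by -1, as [shear_origami] takes natural exponents: shearing it once
    gives back O. *)
Definition unshear (O : origami) : origami := Origami (unshear_transitive O).

Section Parabolic.
Context {R : realType}.

Lemma shear_origami1 (O : origami) (k : nat) :
  (glue_right O ^+ k = 1)%g -> shear_origami O k = O.
Proof.
move=> a1; transitivity (Origami (origami_transitive O)); last by case: O {a1}.
by apply: origami_eq; rewrite a1 invg1 mul1g.
Qed.

Lemma affine_equiv_twist (O : origami) (k : nat) :
  (glue_right O ^+ k = 1)%g -> affine_equiv O O (mx2 1 k%:R 0 1 : 'M[R]_2).
Proof. by move=> a1; rewrite -{2}(shear_origami1 a1); apply: affine_equiv_shear. Qed.

Lemma affine_equiv_unshear (O : origami) :
  affine_equiv (unshear O) O (mx2 1 1 0 1 : 'M[R]_2).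
Proof.
have {2}<- : shear_origami (unshear O) 1 = O; last exact: affine_equiv_shear.
transitivity (Origami (origami_transitive O)); last by case: O.
by apply: origami_eq; rewrite /= expg1 mulKg.
Qed.

Lemma invmx_mx2 (K : comUnitRingType) (a b c d : K) : a * d - b * c = 1 ->
  mx2 a b c d \in unitmx /\ invmx (mx2 a b c d) = mx2 d (- b) (- c) a.
Proof.
move=> h; have u : mx2 a b c d \in unitmx by rewrite unitmxE det_mx2E h unitr1.
split=> //; apply: (can_inj (mulKmx u)); rewrite mulmxV // mulmx_mx2 mx2_1.
by congr mx2; rewrite -?h; ring.
Qed.

Lemma affine_equiv_swapV (O : origami) :
  affine_equiv (transpose O) O (mx2 0 1 1 0 : 'M[R]_2).
Proof.
have SS : mx2 0 1 1 0 *m mx2 0 1 1 0 = 1%:M :> 'M[R]_2.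
  by rewrite mulmx_mx2 mx2_1; congr mx2; ring.
have [u _] := mulmx1_unit SS.
have -> : mx2 0 1 1 0 = invmx (mx2 0 1 1 0) :> 'M[R]_2.
  by apply: (can_inj (mulKmx u)); rewrite mulmxV.
by apply: affine_equiv_inv => //; apply: affine_equiv_swap.
Qed.

Lemma affine_equiv_conj (O O' : origami) (A B C : 'M[R]_2) : B \in unitmx ->
  affine_equiv O' O B -> affine_equiv O' O' A -> C *m B = B *m A ->
  affine_equiv O O C.
Proof.
move=> Bu hB hA CB; rewrite -(mulmxK Bu C) CB.
apply: affine_equiv_comp (affine_equiv_inv Bu hB).
exact: affine_equiv_comp hA.
Qed.

(* The fourth power of the parabolic matrix fixing (1, 1). *)
Lemma affine_equiv_parabolic11 (O : origami) :
  ((glue_up O * glue_right O) ^+ 4 = 1)%g ->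
  affine_equiv O O (mx2 (- 3%:R) 4%:R (- 4%:R) 5%:R : 'M[R]_2).
Proof.
(* [transpose Z] has horizontal gluing sigma_b sigma_a, and maps to O by (1 0; 1 1), which takes (1,
   0) to (1, 1). *)
move=> ba; pose Z := unshear (transpose O).
have UO : affine_equiv (transpose Z) O (mx2 1 0 1 1 : 'M[R]_2).
  have := affine_equiv_comp (affine_equiv_swapV O)
    (affine_equiv_comp (affine_equiv_unshear (transpose O)) (affine_equiv_swapV Z)).
  rewrite !mulmx_mx2; congr affine_equiv; congr mx2; ring.
have TZ : affine_equiv (transpose Z) (transpose Z) (mx2 1 4%:R 0 1 : 'M[R]_2).
  exact: affine_equiv_twist.
have [Uu _] := @invmx_mx2 R 1 0 1 1 ltac:(ring).
apply: (affine_equiv_conj Uu UO TZ).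
by rewrite !mulmx_mx2; congr mx2; ring.
Qed.

(* The fourth power of the parabolic matrix fixing (2, 1). *)
Lemma affine_equiv_parabolic21 (O : origami) :
  ((glue_right O * glue_up O * glue_right O) ^+ 4 = 1)%g ->
  affine_equiv O O (mx2 (- 7%:R) 16%:R (- 4%:R) 9%:R : 'M[R]_2).
Proof.
move=> aba; have [Tu _] := @invmx_mx2 R 1 1 0 1 ltac:(ring).
(* In [unshear O] this product of gluings is sigma_a sigma_b sigma_a, and T takes (1, 1) to (2,
   1). *)
have h : ((glue_up (unshear O) * glue_right (unshear O)) ^+ 4 = 1)%g by [].
apply: (affine_equiv_conj Tu (affine_equiv_unshear O) (affine_equiv_parabolic11 h)).
by rewrite !mulmx_mx2; congr mx2; ring.
Qed.

End Parabolic.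

(** j is 0 modulo the 2-part of 4N and 1 modulo 3 times the odd part of N. The factor 4 makes V^j
    and W^j available, the factor 3 makes T^(j-1) available. *)
Lemma chinese_exponent (N : nat) : (0 < N)%N ->
  exists i j, [/\ j = (3 * i).+1, (4 %| j)%N & (N %| j * (3 * i))%N].
Proof.
move=> N0; have [M M2 NE] := pfactor_coprime (isT : prime 2) N0.
set e := logn 2 N in NE.
have co : coprime (2 ^ e.+2) (3 * M) by rewrite coprimeXl // coprimeMr M2.
pose j := chinese (2 ^ e.+2) (3 * M) 0 1.
have M0 : (0 < M)%N by move: N0; rewrite NE muln_gt0 => /andP[].
have j2 : (2 ^ e.+2 %| j)%N by rewrite /dvdn /j (chinese_modl co) mod0n.
have jM : (j = 1 %[mod 3 * M])%N := chinese_modr co _ _.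
have j0 : (0 < j)%N by move: jM; case: (j) => //; rewrite mod0n modn_small //; lia.
have jM' : (3 * M %| j.-1)%N by rewrite -subn1 -eqn_mod_dvd //; apply/eqP.
have [q jq] : exists q, j.-1 = (3 * (q * M))%N.
  by have /dvdnP[q jq] := jM'; exists q; rewrite jq; lia.
exists (q * M)%N, j; split; first by rewrite -jq prednK.
  by apply: dvdn_trans j2; rewrite !expnS mulnA dvdn_mulr.
have {j2}/dvdnP[p ->] := j2.
rewrite -jq NE jq !expnS; apply/dvdnP; exists (p * 12 * q)%N; lia.
Qed.

Section Noncongruence.

Lemma mod_ideal (N : nat) (t a b : int) : a - b = N%:Z * t -> (a = b %[mod N%:Z])%Z.
Proof. by move=> h; apply/eqP; rewrite eqz_mod_dvd h dvdz_mulr. Qed.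

(* If j = 0 modulo the 2-part of N and j = 1 modulo its odd part, then the words
   T^(1-j) and V^j W^j V^-j in H are congruent to T modulo one part and to 1 modulo
   the other; so their product is congruent to T modulo N. *)
Lemma shear_mem (H : 'M[int]_2 -> Prop) (N : nat) : (0 < N)%N ->
  (forall A B, H A -> H B -> H (A *m B)) ->
  (forall a b c d, a * d - b * c = 1 -> H (mx2 a b c d) -> H (mx2 d (- b) (- c) a)) ->
  (forall B : 'M[int]_2, \det B = 1 ->
     (forall i j, B i j = (1%:M : 'M[int]_2) i j %[mod N%:Z])%Z -> H B) ->
  H (mx2 1 3 0 1) -> H (mx2 (- 3) 4 (- 4) 5) -> H (mx2 (- 7) 16 (- 4) 9) ->
  H (mx2 1 1 0 1).
Proof.
move=> N0 HM HV HN HT HV4 HW4.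
have H1 : H 1%:M by apply: HN; rewrite ?det1.
have HT' (i : nat) : H (mx2 1 (3 * i%:Z) 0 1).
  elim: i => [|i IHi]; first by rewrite (_ : mx2 _ _ _ _ = 1%:M) // mx2_1; congr mx2; lia.
  have := HM _ _ HT IHi; rewrite mulmx_mx2; congr H; congr mx2; lia.
have HV4' (i : nat) : H (mx2 (1 - 4 * i%:Z) (4 * i%:Z) (- (4 * i%:Z)) (1 + 4 * i%:Z)).
  elim: i => [|i IHi]; first by rewrite (_ : mx2 _ _ _ _ = 1%:M) // mx2_1; congr mx2; lia.
  have := HM _ _ HV4 IHi; rewrite mulmx_mx2; congr H; congr mx2; lia.
have HW4' (i : nat) : H (mx2 (1 - 8 * i%:Z) (16 * i%:Z) (- (4 * i%:Z)) (1 + 8 * i%:Z)).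
  elim: i => [|i IHi]; first by rewrite (_ : mx2 _ _ _ _ = 1%:M) // mx2_1; congr mx2; lia.
  have := HM _ _ HW4 IHi; rewrite mulmx_mx2; congr H; congr mx2; lia.
have [i [j [ji /dvdnP[k jk] /dvdnP[t jt]]]] := chinese_exponent N0.
pose J := 4 * k%:Z : int.
have JE : J = 3 * i%:Z + 1 by rewrite /J; lia.
have Jt : J * (3 * i%:Z) = N%:Z * t%:Z by rewrite /J; nia.
have i3 : 3 * i%:Z = J - 1 by rewrite JE; ring.
have := HV _ _ _ _ _ (HT' i); rewrite i3 oppr0 => /(_ ltac:(ring)) HTj.
have HVj := HV4' k; have HWj := HW4' k.
have := HV _ _ _ _ _ HVj; rewrite -/J => /(_ ltac:(ring)) HVj'.
rewrite i3 in Jt.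
have {HVj HWj}[HVj HWj] : H (mx2 (1 - J) J (- J) (1 + J)) /\
    H (mx2 (1 - 2 * J) (4 * J) (- J) (1 + 2 * J)).
  by split; [move: HVj|move: HWj]; congr H; congr mx2; rewrite /J; lia.
clear JE i3; move: J Jt HVj HWj HVj' HTj => J Jt HVj HWj HVj' HTj.
(* (p, q) is V^J (2, 1), so V^J W^J V^-J is the parabolic matrix 1 + J (-pq p^2; -q^2 pq) fixing
   it. *)
pose p := 2 - J; pose q := 1 - J.
have HP : H (mx2 (1 - J * p * q) (J * p ^+ 2) (- (J * q ^+ 2)) (1 + J * p * q)).
  have := HM _ _ HVj (HM _ _ HWj HVj'); rewrite !mulmx_mx2.
  by congr H; congr mx2; rewrite /p /q; ring.
have HX := HM _ _ HTj HP.
have Jq : J * q = N%:Z * - t%:Z by rewrite mulrN -Jt /q; ring.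
(* The entries of T^-1 X, where X = T^(1-J) V^J W^J V^-J; they differ from those of 1 by multiples
   of J q, hence of N. *)
pose y11 := 1 + J * q * (J * q - p); pose y12 := J * q * (2 + q - J * p).
pose y21 := - (J * q * q); pose y22 := 1 + J * q * p.
have detY : y11 * y22 - y12 * y21 = 1.
  by rewrite /y11 /y12 /y21 /y22 /p /q; ring.
have HY : H (mx2 y11 y12 y21 y22).
  apply: HN; first by rewrite det_mx2E.
  by do 2!apply: forall_ord2; rewrite !mxE /=; apply: (@mod_ideal _ (- t%:Z * _));
    rewrite mulrA -Jq /y11 /y12 /y21 /y22;
    first [by rewrite addrC addKr|by rewrite subr0|by rewrite subr0 -mulrN].
have := HM _ _ HX (HV _ _ _ _ detY HY); rewrite !mulmx_mx2; congr H.
by congr mx2; rewrite /y11 /y12 /y21 /y22 /p /q; ring.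
Qed.

Lemma map_mx2 (K L : Type) (g : K -> L) (a b c d : K) :
  map_mx g (mx2 a b c d) = mx2 (g a) (g b) (g c) (g d).
Proof. by apply: mx2P; rewrite !mxE. Qed.

Lemma noncongruence_of_parabolics (R : realType) (G : set 'M[R]_2) :
  subgroup_SL2Z G -> G (mx2 1 3%:R 0 1) -> G (mx2 (- 3%:R) 4%:R (- 4%:R) 5%:R) ->
  G (mx2 (- 7%:R) 16%:R (- 4%:R) 9%:R) -> ~ G (mx2 1 1 0 1) ->
  noncongruence_group G.
Proof.
move=> GG GT GV GW GT1; split=> // -[[GS G1 GM GI] [N [N0 HN]]]; apply: GT1.
pose H (B : 'M[int]_2) := G (map_mx intr B).
have E (a b c d : int) : H (mx2 a b c d) = G (mx2 a%:~R b%:~R c%:~R d%:~R).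
  by rewrite /H map_mx2.
have -> : G (mx2 1 1 0 1) = H (mx2 1 1 0 1) by rewrite E.
apply: (shear_mem N0); rewrite ?E //.
- by move=> A B; rewrite /H map_mxM; apply: GM.
- move=> a b c d; rewrite !E => /(congr1 (intr : int -> R)).
  rewrite rmorphB !rmorphM => /invmx_mx2[_] /= iE /GI; rewrite iE.
  by rewrite !rmorphN.
by move=> B B1 BN; apply: HN; exists B.
Qed.

End Noncongruence.

(** * Descent along the cyclic covers *)

Section SquareMap.
Context {R : realType}.

Definition square_map {O O'} (p : 'I_(degree O) -> 'I_(degree O')) (P : surface R O) :
  surface R O' := mkpt (p (square P)) (XYP P).

Lemma square_mapE {O O'} (p : 'I_(degree O) -> 'I_(degree O')) (P : surface R O) :
  [/\ square (square_map p P) = p (square P), X (square_map p P) = X P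
    & Y (square_map p P) = Y P].
Proof. exact: mkptE. Qed.

Lemma square_map_unique {O O'} (p : 'I_(degree O) -> 'I_(degree O'))
    (h : surface R O -> surface R O') P :
  [/\ square (h P) = p (square P), X (h P) = X P & Y (h P) = Y P] -> h P = square_map p P.
Proof. by move=> [? ? ?]; have [? ? ?] := square_mapE p P; apply: surfaceP; congruence. Qed.

Lemma square_map_comp {O O' O''} (p : 'I_(degree O) -> 'I_(degree O'))
    (p' : 'I_(degree O') -> 'I_(degree O'')) (P : surface R O) :
  square_map p' (square_map p P) = square_map (p' \o p) P.
Proof.
have [h1 h2 h3] := square_mapE p P; have [h4 h5 h6] := square_mapE p' (square_map p P).
by apply: (square_map_unique (h := square_map p' \o square_map p)) => /=; split; congruence.
Qed.

Lemma eq_square_map {O O'} (p p' : 'I_(degree O) -> 'I_(degree O')) (P : surface R O) :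
  p =1 p' -> square_map p P = square_map p' P.
Proof.
by move=> pp; apply: square_map_unique; rewrite -pp; apply: square_mapE.
Qed.

Lemma square_map_id {O} (P : surface R O) : square_map id P = P.
Proof. by apply/esym; apply: (square_map_unique (h := id)). Qed.

Lemma nbr_square_map {O O'} (p : 'I_(degree O) -> 'I_(degree O')) :
  (forall i, p (glue_right O i) = glue_right O' (p i)) ->
  (forall i, p (glue_up O i) = glue_up O' (p i)) ->
  forall (P : surface R O) s t Q, nbr P s t Q -> nbr (square_map p P) s t (square_map p Q).
Proof.
move=> pr pu P s t Q.
have [h1 h2 h3] := square_mapE p P; have [h4 h5 h6] := square_mapE p Q.
rewrite /nbr h1 h2 h3 h4 h5 h6.
move=> [[-> ? ?]|[<- ? ? ?]|[<- ? ? ?]]; rewrite ?pr ?pu;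
  by [constructor 1|constructor 2|constructor 3].
Qed.

Lemma lin_id s t : lin0 (1%:M : 'M[R]_2) s t = s /\ lin1 (1%:M : 'M[R]_2) s t = t.
Proof. by rewrite /lin0 /lin1 !mxE /= !mul1r !mul0r addr0 add0r. Qed.

Lemma square_map_affine {O O'} (p : 'I_(degree O) -> 'I_(degree O')) :
  (forall i, p (glue_right O i) = glue_right O' (p i)) ->
  (forall i, p (glue_up O i) = glue_up O' (p i)) ->
  local_affine 1%:M (square_map p : surface R O -> surface R O').
Proof.
move=> pr pu P; exists 1 => // s t _ Q /(nbr_square_map pr pu).
by have [-> ->] := lin_id s t.
Qed.

End SquareMap.

Section Tower.
Local Open Scope classical_set_scope.
Context {R : realType}.
Variables (l : nat) (F G : nat -> nat) (c x0 : nat).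
Hypothesis st : staircase l F G c x0.

Definition covers_staircase (O : origami) (n : nat) : Prop :=
  [/\ (0 < n)%N, degree O = (l * n)%N, lifts F (glue_right O) & lifts G (glue_up O)].

Lemma Veech_shear_dvd (O : origami) (n k : nat) : covers_staircase O n ->
  Veech_group R O (mx2 1 k%:R 0 1) <-> (3 * n %| k)%N.
Proof.
move=> [n0 dE hF hG]; have det1 : \det (mx2 1 k%:R 0 1 : 'M[R]_2) = 1.
  by rewrite det_mx2E; ring.
split=> [/VeechE[_ hA]|kn].
  have Tu : (mx2 1 k%:R 0 1 : 'M[R]_2) \in unitmx by rewrite unitmxE det1 unitr1.
  have := affine_equiv_comp hA (affine_equiv_inv Tu (affine_equiv_shear O k)).
  rewrite mulmxV // => -[h hb /(translation_perm hb)[p [_ pa pb]]].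
  exact: (twist_order st n0 dE hF hG pa pb).
apply/VeechE; rewrite det1; split=> //; apply: affine_equiv_twist.
apply/permP => x; rewrite perm1 permX.
by move: x; apply/(order_dvd st n0 dE hF).
Qed.

Section Descend.
Variables (O O' : origami) (n m : nat).
Hypotheses (cO : covers_staircase O m) (cO' : covers_staircase O' n) (nm : (n %| m)%N).

Let n0 : (0 < n)%N. Proof. by have [] := cO'. Qed.
Let m0 : (0 < m)%N. Proof. by have [] := cO. Qed.
Let dE : degree O = (l * m)%N. Proof. by have [] := cO. Qed.
Let dE' : degree O' = (l * n)%N. Proof. by have [] := cO'. Qed.
Let ro := res st m0 dE.
Let rn := res st n0 dE'.

Let dd : (degree O' %| degree O)%N.
Proof. by rewrite dE dE' dvdn_pmul2l ?(stair_gt0 st). Qed.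

Definition cover_sq (i : 'I_(degree O)) : 'I_(degree O') := rn i.
Definition deck_sq (s : nat) (i : 'I_(degree O)) : 'I_(degree O) := ro (i + l * s).

Lemma cover_sq_res x : cover_sq (ro x) = rn x.
Proof. by apply/res_eq; rewrite /= modn_dvdm. Qed.

Lemma deck_sq_res s x : deck_sq s (ro x) = ro (x + l * s).
Proof. by apply/res_eq; rewrite /= modnDml. Qed.

Lemma cover_sq_glue : (forall i, cover_sq (glue_right O i) = glue_right O' (cover_sq i)) /\
  (forall i, cover_sq (glue_up O i) = glue_up O' (cover_sq i)).
Proof.
have [_ _ hF hG] := cO; have [_ _ hF' hG'] := cO'.
split=> i; rewrite -(resK st m0 dE i) -/ro cover_sq_res.
  by rewrite (lifts_res st m0 dE (stairF st)) //
    (lifts_res st n0 dE' (stairF st)) // cover_sq_res.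
by rewrite (lifts_res st m0 dE (stairG st)) // (lifts_res st n0 dE' (stairG st)) // cover_sq_res.
Qed.

Lemma deck_sq_glue s : (forall i, deck_sq s (glue_right O i) = glue_right O (deck_sq s i)) /\
  (forall i, deck_sq s (glue_up O i) = glue_up O (deck_sq s i)).
Proof.
have [_ _ hF hG] := cO.
split=> i; rewrite -(resK st m0 dE i) -/ro deck_sq_res.
  by rewrite !(lifts_res st m0 dE (stairF st)) // deck_sq_res (shift_mul (stairF st)).
by rewrite !(lifts_res st m0 dE (stairG st)) // deck_sq_res (shift_mul (stairG st)).
Qed.

Lemma deck_sq_comp s s' i : deck_sq s (deck_sq s' i) = deck_sq (s' + s) i.
Proof. by rewrite -(resK st m0 dE i) -/ro !deck_sq_res mulnDr addnA. Qed.

Lemma deck_sq_id s i : deck_sq s i = i <-> (m %| s)%N.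
Proof.
have -> : (m %| s)%N = (l * s == 0 %[mod degree O])%N.
  by rewrite mod0n dE -muln_modr muln_eq0 gtn_eqF ?(stair_gt0 st).
rewrite -{2}(resK st m0 dE i) -res_eq -[X in _ = X %[mod _]]addn0.
by split=> [/eqP|h]; [|apply/eqP]; rewrite eqn_modDl.
Qed.

Lemma cover_deck s i : (n %| s)%N -> cover_sq (deck_sq s i) = cover_sq i.
Proof.
move=> ns; rewrite -(resK st m0 dE i) -/ro deck_sq_res !cover_sq_res.
apply/res_eq/eqP; rewrite -[X in _ == X %[mod _]]addn0 eqn_modDl mod0n dE' -muln_modr.
by rewrite (eqP ns) muln0.
Qed.

Lemma cover_sq_fiber i j : cover_sq i = cover_sq j -> exists k, j = deck_sq (n * k) i.
Proof.
move=> /res_eq /eqP ij.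
(* Adding [degree O] keeps the subtraction of i from being truncated. *)
have il : (i <= j + degree O)%N by rewrite (leq_trans (ltnW (ltn_ord i))) ?leq_addl.
have : (degree O' %| j + degree O - i)%N.
  rewrite -eqn_mod_dvd // -modnDmr (eqP dd) addn0 eq_sym.
  by [].
move=> /dvdnP[k E]; exists k.
rewrite -(resK st m0 dE j) /deck_sq -/ro; apply/res_eq.
rewrite mulnA -dE' mulnC -E subnKC // -modnDmr modnn addn0 //.
Qed.

Definition cover_map : surface R O -> surface R O' := square_map cover_sq.
Definition deck_map (s : nat) : surface R O -> surface R O := square_map (deck_sq s).

Lemma deck_map_comp s s' P : deck_map s (deck_map s' P) = deck_map (s' + s) P.
Proof.
rewrite /deck_map square_map_comp; apply: eq_square_map => i; exact: deck_sq_comp.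
Qed.

Lemma deck_map_id s P : deck_map s P = P <-> (m %| s)%N.
Proof.
rewrite -(deck_sq_id s (square P)); have [h1 h2 h3] := square_mapE (deck_sq s) P.
split=> [e|e]; first by rewrite -h1 -/(deck_map s P) e.
by apply: surfaceP; rewrite ?h1 ?h2 ?h3.
Qed.

Lemma deck_map_bij s : (s <= m)%N -> bijective (deck_map s).
Proof.
move=> sm; exists (deck_map (m - s)) => P; rewrite deck_map_comp; apply/deck_map_id.
  by rewrite subnKC.
by rewrite subnK.
Qed.

Lemma cover_deck_map s P : (n %| s)%N -> cover_map (deck_map s P) = cover_map P.
Proof.
by move=> ns; rewrite /cover_map square_map_comp; apply: eq_square_map => i; apply: cover_deck.
Qed.

Lemma cover_map_fiber P Q : cover_map P = cover_map Q -> exists k, Q = deck_map (n * k) P.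
Proof.
move=> PQ; have [h1 h2 h3] := square_mapE cover_sq P.
have [h4 h5 h6] := square_mapE cover_sq Q; rewrite -!/(cover_map _) in h1 h2 h3 h4 h5 h6.
have [|k hk] := @cover_sq_fiber (square P) (square Q); first by rewrite -h1 -h4 PQ.
exists k; apply: (square_map_unique (h := fun=> Q)); split=> //; congruence.
Qed.

(* Conjugation by f sends the generator deck_map n of the deck group of the cover
   to a translation automorphism, that is, to some deck_map s; comparing orders,
   n divides s. *)
Lemma affine_cover_fiber (A : 'M[R]_2) (f : surface R O -> surface R O) P Q :
  bijective f -> A \in unitmx -> local_affine A f ->
  cover_map P = cover_map Q -> cover_map (f P) = cover_map (f Q).
Proof.
move=> fb Au fA; have [g fK gK] := fb; have gA := local_affine_inv Au fK gK fA.
have [_ _ hF hG] := cO.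
have nlem : (n <= m)%N by apply: dvdn_leq.
pose h := f \o deck_map n \o g.
have hb : bijective h.
  by apply: bij_comp; [apply: bij_comp => //; apply: deck_map_bij|exists f].
have h1 : local_affine 1%:M h.
  have [dr du] := deck_sq_glue n.
  have := local_affine_comp (local_affine_comp fA (square_map_affine dr du)) gA.
  by rewrite mulmx1 mulmxV.
have [p [hp pa pb]] := translation_perm hb h1.
(* The untwisted case k = 0: a translation automorphism is a shift by blocks. *)
have [|s hs] := @intertwiner_translation _ _ _ _ _ st _ _ m0 dE _ _ hF hG 0 p pa.
  by move=> x; rewrite expg0 invg1 mul1g pb.
have hE S : h S = deck_map s S.
  rewrite (square_map_unique (hp S)); apply: eq_square_map => i.
  by rewrite -{1}(resK st m0 dE i) hs.
have /dvdnP[j mj] := nm.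
have hi i S : iter i h S = deck_map (s * i) S.
  elim: i => [|i IHi]; first by apply/esym/deck_map_id; rewrite muln0 dvdn0.
  by rewrite iterS IHi hE deck_map_comp mulnS addnC.
have hi' i S : iter i h S = f (deck_map (n * i) (g S)).
  elim: i => [|i IHi]; first by rewrite (_ : deck_map _ _ = g S) ?gK //;
    apply/deck_map_id; rewrite muln0 dvdn0.
  by rewrite iterS IHi /h /= fK deck_map_comp mulnS addnC.
(* With m = j n, the j-th iterate of h is the shift by s j blocks and also a conjugate of the shift
   by m, which is trivial; so m divides s j. *)
have ns : (n %| s)%N.
  have j0 : (0 < j)%N by move: m0; rewrite mj muln_gt0 => /andP[].
  rewrite -(dvdn_pmul2r j0) -[X in (X %| _)%N]mulnC -mj; apply/(deck_map_id _ P).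
  by rewrite -hi hi' mulnC -mj (_ : deck_map m (g P) = g P) ?gK //; apply/deck_map_id.
have fn S : cover_map (f (deck_map n S)) = cover_map (f S).
  by rewrite -(cover_deck_map (f S) ns) -hE /h /= fK.
move=> /cover_map_fiber[k ->]; elim: k => [|k IHk].
  by congr (cover_map (f _)); apply/esym/deck_map_id; rewrite muln0 dvdn0.
by rewrite mulnS addnC -deck_map_comp fn.
Qed.

Lemma Veech_descend : Veech_group R O `<=` Veech_group R O'.
Proof.
move=> A VA; have [Au _] := SL2Z_unit (Veech_SL2Z VA).
have /VeechE[A0 [f fb fA]] := VA; apply/VeechE; split=> //.
(* A set-theoretic section, in general not continuous; by [affine_cover_fiber] the induced map does
   not depend on it. *)
pose sec_sq (i : 'I_(degree O')) : 'I_(degree O) := ro i.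
pose sec : surface R O' -> surface R O := square_map sec_sq.
have secK P : cover_map (sec P) = P.
  rewrite /cover_map /sec square_map_comp -[RHS]square_map_id; apply: eq_square_map => i /=.
  by rewrite cover_sq_res /rn resK.
have [g fK gK] := fb; have gA := local_affine_inv Au fK gK fA.
have gb : bijective g by exists f.
have Vu : invmx A \in unitmx by rewrite unitmx_inv.
pose f' := cover_map \o f \o sec; pose g' := cover_map \o g \o sec.
have f'E P : f' (cover_map P) = cover_map (f P).
  by rewrite /f' /=; apply: (affine_cover_fiber fb Au fA); rewrite secK.
have g'E P : g' (cover_map P) = cover_map (g P).
  by rewrite /g' /=; apply: (affine_cover_fiber gb Vu gA); rewrite secK.
have [qr qu] := cover_sq_glue.
exists f'.
  by exists g' => P; rewrite -[P]secK; [rewrite f'E g'E fK|rewrite g'E f'E gK].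
move=> P'; have [e1 e1_0 he1] := fA (sec P'); have [e2 e2_0 he2] := nbr_ex (sec P').
exists (Num.min e1 e2); first by rewrite lt_min e1_0.
move=> s t h Q' PQ'.
have s1 : small e1 s t by apply: smallW h; rewrite ge_min lexx.
have s2 : small e2 s t by apply: smallW h; rewrite ge_min lexx orbT.
(* The displacement from P' is lifted to one from [sec P'], where f is affine, and projected
   back. *)
have [Q PQ] := he2 _ _ s2.
have := nbr_square_map qr qu PQ; rewrite -!/(cover_map _) secK => /(nbr_inj PQ') ->.
rewrite f'E; exact: (nbr_square_map qr qu (he1 _ _ s1 _ PQ)).
Qed.

End Descend.
End Tower.

(** * The three statements, for an abstract tower of covers *)

Section Final.
Local Open Scope classical_set_scope.
Variable R : realType.

Lemma iter_perm_eq1 (l : nat) (F G : nat -> nat) (c x0 : nat) (st : staircase l F G c x0)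
    (O : origami) (cO : covers_staircase l F G O 1) (g : 'S_(degree O)) (H : nat -> nat) k :
  (forall x, H (x + l)%N = (H x + l)%N) -> lifts H g ->
  (forall x, (x < l)%N -> iter k H x = x %[mod l]) -> (g ^+ k = 1)%g.
Proof.
move=> HS hg Hk; have [n0 dE _ _] := cO.
apply/permP => x; rewrite perm1 permX -(resK st n0 dE x) (iter_res st n0 dE HS hg).
have xl : (x < l)%N by have := ltn_ord x; rewrite [X in (_ < X)%N]dE muln1.
by apply/res_eq; move: (Hk x xl); move: (nat_of_ord x) => y; rewrite dE muln1.
Qed.

Lemma lifts_mul (l : nat) (F G : nat -> nat) (c x0 : nat) (st : staircase l F G c x0)
    (d n : nat) (n0 : (0 < n)%N) (dE : d = (l * n)%N) (a b : 'S_d) (H K : nat -> nat) :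
  (forall x, H (x + l)%N = (H x + l)%N) -> (forall x, K (x + l)%N = (K x + l)%N) ->
  lifts H a -> lifts K b -> lifts (K \o H) (a * b)%g.
Proof.
move=> HS KS ha hb x.
rewrite permM -(resK st n0 dE x) (lifts_res st n0 dE HS ha) (lifts_res st n0 dE KS hb).
by rewrite resK.
Qed.

(** The two hypotheses on fourth powers are finite checks on residues; they feed V^4 and W^4 into
    the non congruence argument. For distinctness, equal groups contain the same powers of T, so 3n
    and 3m divide each other. *)
Lemma tower_main (l : nat) (F G : nat -> nat) (c x0 : nat) (st : staircase l F G c x0)
    (O : forall n : nat, (0 < n)%N -> origami)
    (cO : forall n hn, covers_staircase l F G (O n hn) n) :
  (forall x, (x < l)%N -> iter 4 (F \o G) x = x %[mod l]) ->
  (forall x, (x < l)%N -> iter 4 (F \o (G \o F)) x = x %[mod l]) ->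
  [/\ (forall (n : nat) (hn : (0 < n)%N),
         Veech_group R (O n hn) `<=` Veech_group R (O 1%N isT))
      /\ noncongruence_group (Veech_group R (O 1%N isT)),
      forall (n m : nat) (hn : (0 < n)%N) (hm : (0 < m)%N),
        (n %| m)%N -> Veech_group R (O m hm) `<=` Veech_group R (O n hn)
    & forall (n m : nat) (hn : (0 < n)%N) (hm : (0 < m)%N),
        n <> m -> Veech_group R (O n hn) <> Veech_group R (O m hm)].
Proof.
move=> FG4 FGF4.
have desc n m hn hm : (n %| m)%N -> Veech_group R (O m hm) `<=` Veech_group R (O n hn).
  by move=> nm; apply: (Veech_descend st (cO m hm) (cO n hn) nm).
have T n hn k := @Veech_shear_dvd R _ _ _ _ _ st (O n hn) n k (cO n hn).
split=> //.
  split=> [n hn|]; first exact: desc.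
  have cO1 := cO 1%N isT; have [n0 dE hF hG] := cO1.
  have [FS GS] := (stairF st, stairG st).
  have ba : ((glue_up (O 1%N isT) * glue_right (O 1%N isT)) ^+ 4 = 1)%g.
    apply: (iter_perm_eq1 st cO1 (H := F \o G)) FG4; first by move=> x /=; rewrite GS FS.
    exact: (lifts_mul st n0 dE).
  have aba :
      ((glue_right (O 1%N isT) * glue_up (O 1%N isT) * glue_right (O 1%N isT)) ^+ 4 = 1)%g.
    apply: (iter_perm_eq1 st cO1 (H := F \o (G \o F))) FGF4.
      by move=> x /=; rewrite FS GS FS.
    apply: (lifts_mul st n0 dE) => //; first by move=> x /=; rewrite FS GS.
    exact: (lifts_mul st n0 dE).
  apply: noncongruence_of_parabolics; first exact: Veech_subgroup.
  - exact/T.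
  - by apply/VeechE; split; [rewrite det_mx2E; lra|apply: affine_equiv_parabolic11].
  - by apply/VeechE; split; [rewrite det_mx2E; lra|apply: affine_equiv_parabolic21].
  by move=> /(T 1%N isT 1%N).
move=> n m hn hm nm E; apply: nm; apply/eqP; rewrite eqn_dvd.
have mn : (3 * m %| 3 * n)%N by apply/(T m hm); rewrite -E; apply/T.
have nm : (3 * n %| 3 * m)%N by apply/(T n hn); rewrite E; apply/T.
by move: mn nm; rewrite !dvdn_pmul2l // => -> ->.
Qed.

End Final.

Local Open Scope classical_set_scope.

Theorem proposition4p2 (R : realType)
    (O : forall n : nat, (0 < n)%N -> origami)
    (hO : O = L23_origami \/ O = D_origami) :
  [/\ (forall (n : nat) (hn : (0 < n)%N),
         Veech_group R (O n hn) `<=` Veech_group R (O 1%N isT))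
      /\ noncongruence_group (Veech_group R (O 1%N isT)),
      forall (n m : nat) (hn : (0 < n)%N) (hm : (0 < m)%N),
        (n %| m)%N -> Veech_group R (O m hm) `<=` Veech_group R (O n hn)
    & forall (n m : nat) (hn : (0 < n)%N) (hm : (0 < m)%N),
        n <> m -> Veech_group R (O n hn) <> Veech_group R (O m hm)].
Proof.
case: hO => ->.
  apply: (tower_main R L23_staircase) => [n hn||].
  - by split=> //; [apply: L23_right_lifts|apply: L23_up_lifts].
  - by case=> [|[|[|[|//]]]].
  - by case=> [|[|[|[|//]]]].
apply: (tower_main R D_staircase) => [n hn||].
- by split=> //; [apply: D_right_lifts|apply: D_up_lifts].
- by case=> [|[|[|[|[|//]]]]].
- by case=> [|[|[|[|[|//]]]]].
Qed.
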